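(* There exists a bounded sequence $\beta=(\beta_n)_{n\ge0}$ of positive numbers, with polynomial decay, which is not essentially decreasing, and for which every composition operator $C_\varphi$ with symbol $\varphi$ vanishing at $0$ is bounded on $H^2(\beta)$. For this sequence one hence has $\sup_{\varphi(0)=0}\|C_\varphi\|=+\infty$, the supremum being over all symbols $\varphi$ with $\varphi(0)=0$.
   Context: $\mathbb{D}$ is the open unit disk of $\mathbb{C}$. A sequence $\beta=(\beta_n)_{n\ge0}$ of positive numbers has polynomial decay if there are constants $c,\alpha>0$ with $\beta_n\ge c\,n^{-\alpha}$ for all $n\ge1$. It is essentially decreasing if for some constant $C\ge1$ one has $\beta_m\le C\beta_n$ for all $m\ge n\ge0$. $H^2(\beta)$ is the Hilbert space of analytic functions $f(z)=\sum_{n\ge0}a_nz^n$ on $\mathbb{D}$ such that $\|f\|^2=\sum_{n\ge0}|a_n|^2\beta_n<\infty$. A symbol is a non-constant analytic map $\varphi:\mathbb{D}\to\mathbb{D}$, and $C_\varphi(f)=f\circ\varphi$; it is bounded on $H^2(\beta)$ if it maps $H^2(\beta)$ boundedly into itself, and $\|C_\varphi\|$ is its operator norm on $H^2(\beta)$. *)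

(* Defs.v *)
From Stdlib Require Import Reals.
From Coquelicot Require Import Coquelicot.
Open Scope R_scope.

(** Functions on the disk are represented by total functions [C -> C]; every
    definition below only looks at their values on [disk]. *)
Definition disk (z : C) : Prop := Cmod z < 1.

Definition analytic_at (f : C -> C) (z0 : C) : Prop :=
  exists (a : nat -> C) (r : R), 0 < r /\
    forall h : C, Cmod h < r ->
      @is_pseries C_AbsRing C_NormedModule a h (f (z0 + h)%C).

Definition symbol (phi : C -> C) : Prop :=
  (forall z, disk z -> analytic_at phi z) /\
  (forall z, disk z -> disk (phi z)) /\
  (exists z w, disk z /\ disk w /\ phi z <> phi w).

Definition comp_op (phi f : C -> C) : C -> C := fun z => f (phi z).

Definition positive_seq (beta : nat -> R) : Prop := forall n, 0 < beta n.

Definition bounded_seq (beta : nat -> R) : Prop :=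
  exists M : R, forall n, beta n <= M.

Definition polynomial_decay (beta : nat -> R) : Prop :=
  exists c alpha : R, 0 < c /\ 0 < alpha /\
    forall n : nat, (1 <= n)%nat -> c * Rpower (INR n) (- alpha) <= beta n.

Definition essentially_decreasing (beta : nat -> R) : Prop :=
  exists K : R, 1 <= K /\
    forall m n : nat, (n <= m)%nat -> beta m <= K * beta n.

(** [f(z) = sum_n a_n z^n] on the whole disk; in particular [f] is analytic. *)
Definition expansion (f : C -> C) (a : nat -> C) : Prop :=
  forall z, disk z -> @is_pseries C_AbsRing C_NormedModule a z (f z).

(** [H2 beta f] says that [f] belongs to H^2(beta), and [H2_norm beta f N] that
    moreover its norm is [N].  The norm is a relation because the coefficients
    [a], although unique, are not given with [f]. *)
Definition H2 (beta : nat -> R) (f : C -> C) : Prop :=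
  exists a : nat -> C, expansion f a /\
    ex_series (fun n => Cmod (a n) ^ 2 * beta n).

Definition H2_norm (beta : nat -> R) (f : C -> C) (N : R) : Prop :=
  exists a : nat -> C, expansion f a /\
    ex_series (fun n => Cmod (a n) ^ 2 * beta n) /\
    N = sqrt (Series (fun n => Cmod (a n) ^ 2 * beta n)).

Definition bounded_comp_op (beta : nat -> R) (phi : C -> C) : Prop :=
  (forall f, H2 beta f -> H2 beta (comp_op phi f)) /\
  (exists M : R, forall (f : C -> C) (N N' : R),
     H2_norm beta f N -> H2_norm beta (comp_op phi f) N' -> N' <= M * N).

(** Supremum of the norm of [comp_op phi f] over the unit ball of H^2(beta);
    this is the operator norm when [bounded_comp_op beta phi] holds. *)
Definition comp_op_norm (beta : nat -> R) (phi : C -> C) : Rbar :=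
  Lub_Rbar (fun r : R => exists (f : C -> C) (N : R),
    H2_norm beta f N /\ N <= 1 /\ H2_norm beta (comp_op phi f) r).

(* Main.v *)
(** The weight [beta] is a decreasing step function with rapidly decaying levels, modified at the last
    but one point [d] of each block, where it takes the value of the next level. Then
    [beta_(d+1) / beta_d] is unbounded, so [beta] is not essentially decreasing.

    If [phi(0) = 0], Littlewood's subordination principle on the coefficients up to the end of a block,
    together with the geometric decay of the levels, controls all of [C_phi] except the columns [phi^d],
    whose coefficients in their own block are [c_1^d] and [d * c_1^(d-1) * c_2]. Unless [phi] is a
    rotation, [|c_1| < 1] and these decay exponentially in [d], whereas the ratio of two consecutive
    levels is at most [d]. The bound depends on [|c_1|]: for [phi(z) = z (t + (1-t) z)] with
    [1 - t = 1/(2d)], the coefficient of [z^(d+1)] in [phi^d] is at least [1/4], so that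
    [||C_phi||^2 >= beta_(d+1) / (16 beta_d)].

    Everything about analytic functions rests on one inequality: if [|sum_n c_n z^n| <= M] on a circle,
    multiplication by this series is bounded by [M] on truncated square-summable sequences. This follows
    from Parseval's identity on roots of unity, without integrals, and yields Cauchy's estimate,
    uniqueness of coefficients, and the expansion of a symbol on the whole disk. *)

Require Import Defs.
From Stdlib Require Import Reals Arith Lra Lia ClassicalEpsilon.
From Coquelicot Require Import Coquelicot.
Open Scope R_scope.

(** * Finite sums and roots of unity *)

Fixpoint rsum (n : nat) (f : nat -> R) : R :=
  match n with O => 0 | S k => rsum k f + f k end.

Fixpoint csum (n : nat) (f : nat -> C) : C :=
  match n with O => RtoC 0 | S k => (csum k f + f k)%C end.

Lemma rsum_ext n f g : (forall i, (i < n)%nat -> f i = g i) -> rsum n f = rsum n g.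
Proof.
  induction n; simpl; intros H; trivial.
  now rewrite IHn, H by (intros; try apply H; lia).
Qed.

Lemma rsum_le n f g : (forall i, (i < n)%nat -> f i <= g i) -> rsum n f <= rsum n g.
Proof.
  induction n; simpl; intros H; [lra|].
  apply Rplus_le_compat; [apply IHn; intros; apply H|apply H]; lia.
Qed.

Lemma rsum_plus n f g : rsum n (fun i => f i + g i) = rsum n f + rsum n g.
Proof. induction n; simpl; rewrite ?IHn; lra. Qed.

Lemma rsum_scal n a f : rsum n (fun i => a * f i) = a * rsum n f.
Proof. induction n; simpl; rewrite ?IHn; ring. Qed.

Lemma rsum_const n a : rsum n (fun _ => a) = INR n * a.
Proof. induction n; [simpl; ring|]. simpl rsum. rewrite IHn, S_INR. ring. Qed.

Lemma rsum_ge0 n f : (forall i, (i < n)%nat -> 0 <= f i) -> 0 <= rsum n f.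
Proof.
  intros H. rewrite <- (Rmult_0_r (INR n)), <- rsum_const. now apply rsum_le.
Qed.

Lemma rsum_add n m f : rsum (n + m) f = rsum n f + rsum m (fun i => f (n + i)%nat).
Proof.
  induction m; simpl; [rewrite Nat.add_0_r; lra|].
  rewrite Nat.add_succ_r; simpl; rewrite IHm; lra.
Qed.

Lemma rsum_mono n m f : (forall i, 0 <= f i) -> (n <= m)%nat -> rsum n f <= rsum m f.
Proof.
  intros H L. replace m with (n + (m - n))%nat by lia. rewrite rsum_add.
  assert (0 <= rsum (m - n) (fun i => f (n + i)%nat)) by (apply rsum_ge0; intros; apply H).
  lra.
Qed.

Lemma rsum_term_le n m f : (forall i, 0 <= f i) -> (m < n)%nat -> f m <= rsum n f.
Proof.
  intros H L. apply Rle_trans with (rsum (S m) f); [|apply rsum_mono; trivial; lia].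
  simpl. assert (0 <= rsum m f) by (apply rsum_ge0; auto). lra.
Qed.

(** Subtracting the exceptional term on both sides avoids sums with a hole; the exceptional index
    will be [dip k]. *)
Lemma rsum_change n d f g :
  (d < n)%nat -> (forall i, (i < n)%nat -> i <> d -> f i = g i) ->
  rsum n f - f d = rsum n g - g d.
Proof.
  induction n; [lia|]; intros L H; simpl. destruct (Nat.eq_dec d n) as [->|N].
  - rewrite (rsum_ext n f g); [lra|intros; apply H; lia].
  - rewrite (H n) by lia. specialize (IHn ltac:(lia) ltac:(intros; apply H; lia)). lra.
Qed.

Lemma csum_ext n f g : (forall i, (i < n)%nat -> f i = g i) -> csum n f = csum n g.
Proof.
  induction n; simpl; intros H; trivial.
  now rewrite IHn, H by (intros; try apply H; lia).
Qed.

Lemma csum_0 n f : (forall i, (i < n)%nat -> f i = RtoC 0) -> csum n f = RtoC 0.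
Proof.
  induction n; simpl; intros H; trivial.
  rewrite IHn, H by (intros; try apply H; lia). ring.
Qed.

Lemma csum_plus n f g : csum n (fun i => f i + g i)%C = (csum n f + csum n g)%C.
Proof. induction n; simpl; rewrite ?IHn; ring. Qed.

Lemma csum_scal n a f : csum n (fun i => a * f i)%C = (a * csum n f)%C.
Proof. induction n; simpl; rewrite ?IHn; ring. Qed.

Lemma csum_scal_r n a f : csum n (fun i => f i * a)%C = (csum n f * a)%C.
Proof. induction n; simpl; rewrite ?IHn; ring. Qed.

Lemma csum_add n m f : csum (n + m) f = (csum n f + csum m (fun i => f (n + i)%nat))%C.
Proof.
  induction m; simpl; [rewrite Nat.add_0_r; ring|].
  rewrite Nat.add_succ_r; simpl; rewrite IHm; ring.
Qed.

Lemma csum_shift n f : csum (S n) f = (f 0%nat + csum n (fun i => f (S i)))%C.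
Proof.
  change (S n) with (1 + n)%nat. rewrite csum_add; simpl. ring.
Qed.

Lemma csum_trunc n m f : (n <= m)%nat ->
  (forall i, (n <= i < m)%nat -> f i = RtoC 0) -> csum m f = csum n f.
Proof.
  intros L H. replace m with (n + (m - n))%nat by lia. rewrite csum_add.
  rewrite (csum_0 (m - n)); [ring|]. intros; apply H; lia.
Qed.

Lemma csum_single n d f : (d < n)%nat ->
  (forall i, (i < n)%nat -> i <> d -> f i = RtoC 0) -> csum n f = f d.
Proof.
  intros L H. rewrite (csum_trunc (S d) n) by (try intros; try apply H; lia).
  simpl. rewrite csum_0 by (intros; apply H; lia). ring.
Qed.

Lemma csum_swap n m (f : nat -> nat -> C) :
  csum n (fun i => csum m (f i)) = csum m (fun j => csum n (fun i => f i j)).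
Proof.
  induction n; simpl; [now rewrite csum_0|]. now rewrite IHn, <- csum_plus.
Qed.

Lemma csum_conj n f : Cconj (csum n f) = csum n (fun i => Cconj (f i)).
Proof.
  induction n; simpl; [apply injective_projections; simpl; ring|].
  now rewrite Cplus_conj, IHn.
Qed.

Lemma csum_RtoC n f : csum n (fun i => RtoC (f i)) = RtoC (rsum n f).
Proof. induction n; simpl; trivial. now rewrite IHn, RtoC_plus. Qed.

Lemma csum_mod n f : Cmod (csum n f) <= rsum n (fun i => Cmod (f i)).
Proof.
  induction n; simpl; [rewrite Cmod_0; lra|].
  eapply Rle_trans; [apply Cmod_triangle|lra].
Qed.

Lemma csum_prod n m f g :
  (csum n f * csum m g)%C = csum n (fun i => csum m (fun j => f i * g j)%C).
Proof.
  rewrite <- csum_scal_r. apply csum_ext; intros. now rewrite csum_scal.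
Qed.

Definition cis (t : R) : C := (cos t, sin t).

Lemma cis_0 : cis 0 = RtoC 1.
Proof. unfold cis; now rewrite cos_0, sin_0. Qed.

Lemma cis_plus s t : cis (s + t) = (cis s * cis t)%C.
Proof.
  unfold cis, Cmult; simpl. rewrite cos_plus, sin_plus. f_equal; ring.
Qed.

Lemma cis_conj t : Cconj (cis t) = cis (- t).
Proof. unfold cis, Cconj; simpl. now rewrite cos_neg, sin_neg. Qed.

Lemma cis_mod t : Cmod (cis t) = 1.
Proof.
  unfold cis, Cmod; simpl. rewrite !Rmult_1_r.
  generalize (sin2_cos2 t); unfold Rsqr; intros.
  replace (_ + _) with 1 by lra. apply sqrt_1.
Qed.

Lemma cis_pow t n : (cis t ^ n)%C = cis (INR n * t).
Proof.
  induction n.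
  - simpl; now rewrite Rmult_0_l, cis_0.
  - rewrite Cpow_S, IHn, S_INR, <- cis_plus. f_equal; ring.
Qed.

Lemma cis_turn n : cis (INR n * (2 * PI)) = RtoC 1.
Proof.
  unfold cis. replace (INR n * (2 * PI)) with (0 + 2 * INR n * PI) by ring.
  now rewrite cos_period, sin_period, cos_0, sin_0.
Qed.

Lemma cis_geom n t :
  (csum n (fun j => cis (INR j * t)) * (cis t - 1))%C = (cis (INR n * t) - 1)%C.
Proof.
  induction n; [simpl; rewrite Rmult_0_l, cis_0; ring|].
  simpl csum. rewrite Cmult_plus_distr_r, IHn, S_INR.
  replace ((INR n + 1) * t) with (INR n * t + t) by ring. rewrite cis_plus. ring.
Qed.

(** If the cosine is 1, then [cos (2 s) = 1 - 2 sin^2 s] forces [sin (|t|/2) = 0], whereas [|t|/2]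
    lies strictly between 0 and pi. *)
Lemma cis_neq_1 t : 0 < Rabs t < 2 * PI -> cis t <> RtoC 1.
Proof.
  intros H E. apply (f_equal fst) in E; simpl in E.
  assert (S0 : sin (Rabs t / 2) = 0).
  { assert (E' : cos (Rabs t) = 1)
      by (unfold Rabs; destruct (Rcase_abs t); rewrite ?cos_neg; trivial).
    replace (Rabs t) with (2 * (Rabs t / 2)) in E' by field.
    rewrite cos_2a_sin in E'. nra. }
  assert (0 < sin (Rabs t / 2)) by (apply sin_gt_0; lra). lra.
Qed.

(** Geometric sum with ratio [cis t], where [t = (m - k) 2 pi / L]: the [L]-th power of the ratio is
    1, and for [m <> k] the ratio itself is not 1, because [|m - k| < L]. *)
Lemma root_orthogonality L m k : (m < L)%nat -> (k < L)%nat ->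
  csum L (fun j => cis (INR j * ((INR m - INR k) * (2 * PI / INR L)))) =
  RtoC (if Nat.eq_dec m k then INR L else 0).
Proof.
  intros Hm Hk. assert (HL : 0 < INR L) by (apply lt_0_INR; lia).
  destruct (Nat.eq_dec m k) as [->|N].
  - rewrite (csum_ext L _ (fun _ => RtoC 1)).
    + rewrite csum_RtoC, rsum_const. f_equal; ring.
    + intros. rewrite Rminus_diag, Rmult_0_l, Rmult_0_r. apply cis_0.
  - set (t := (INR m - INR k) * (2 * PI / INR L)).
    assert (G : (csum L (fun j => cis (INR j * t)) * (cis t - 1))%C = RtoC 0).
    { rewrite cis_geom.
      replace (INR L * t) with (INR m * (2 * PI) + - (INR k * (2 * PI)))
        by (unfold t; field; lra).
      rewrite cis_plus, <- cis_conj, !cis_turn.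
      apply injective_projections; simpl; ring. }
    assert (N1 : cis t <> RtoC 1).
    { apply cis_neq_1. unfold t.
      assert (0 < PI) by apply PI_RGT_0.
      assert (0 < / INR L) by now apply Rinv_0_lt_compat.
      assert (0 < 2 * PI / INR L) by (unfold Rdiv; nra).
      rewrite Rabs_mult, (Rabs_pos_eq (2 * PI / INR L)) by lra. split.
      - apply Rmult_lt_0_compat; trivial. apply Rabs_pos_lt.
        intros E. apply N, INR_eq. lra.
      - replace (2 * PI) with (INR L * (2 * PI / INR L)) at 2 by (field; lra).
        apply Rmult_lt_compat_r; trivial. apply lt_INR in Hm, Hk.
        generalize (pos_INR m) (pos_INR k). intros; apply Rabs_def1; lra. }
    destruct (Ceq_dec (csum L (fun j => cis (INR j * t))) 0) as [E|E]; trivial.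
    now destruct (Cmult_neq_0 _ _ E (Cminus_eq_contra _ _ N1)).
Qed.

(** Each squared modulus is expanded as a double sum over [m] and [k]; summing over the roots of
    unity first leaves only the diagonal. *)
Lemma finite_parseval L (p : nat -> C) : (0 < L)%nat ->
  rsum L (fun j => Cmod (csum L (fun m => p m * cis (INR j * (2 * PI / INR L)) ^ m)%C) ^ 2) =
  INR L * rsum L (fun m => Cmod (p m) ^ 2).
Proof.
  intros HL. apply RtoC_inj. set (t := 2 * PI / INR L).
  rewrite <- csum_RtoC.
  rewrite (csum_ext L _ (fun j => csum L (fun m => csum L (fun k =>
     (p m * Cconj (p k)) * cis (INR j * ((INR m - INR k) * t)))%C))).
  2:{ intros j _. rewrite Cmod2_conj, csum_conj, csum_prod.
      apply csum_ext; intros m _; apply csum_ext; intros k _.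
      rewrite !cis_pow, Cmult_conj, cis_conj.
      replace (INR j * ((INR m - INR k) * t))
        with (INR m * (INR j * t) + - (INR k * (INR j * t))) by ring.
      rewrite cis_plus. ring. }
  rewrite csum_swap, RtoC_mult, <- csum_RtoC, <- csum_scal.
  apply csum_ext; intros m Hm. rewrite csum_swap.
  rewrite (csum_ext L _ (fun k =>
     p m * Cconj (p k) * RtoC (if Nat.eq_dec m k then INR L else 0))%C).
  2:{ intros k Hk. rewrite csum_scal. f_equal. now apply root_orthogonality. }
  rewrite (csum_single L m); trivial.
  - destruct (Nat.eq_dec m m); [|lia]. rewrite Cmod2_conj. ring.
  - intros k _ N. destruct (Nat.eq_dec m k); [lia|]. ring.
Qed.

(** * Multiplication by a bounded power series on truncated sequences *)

Definition conv (c g : nat -> C) (m : nat) : C := csum (S m) (fun i => c i * g (m - i)%nat)%C.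

(** [conv c] is a lower triangular Toeplitz matrix, so its first [N] rows see only the first [N]
    entries of [g]. With [c] cut as well, both factors become polynomials, to which Parseval on
    sufficiently many roots of unity applies; the first factor is at most [M + eps] in modulus at
    each root. *)
Lemma toeplitz_contraction c g M N :
  (forall eps, 0 < eps -> exists K, forall k t, (K <= k)%nat ->
     Cmod (csum k (fun n => c n * cis t ^ n)%C) <= M + eps) ->
  rsum N (fun m => Cmod (conv c g m) ^ 2) <= M ^ 2 * rsum N (fun m => Cmod (g m) ^ 2).
Proof.
  intros H. set (G := rsum N (fun m => Cmod (g m) ^ 2)).
  assert (HG : 0 <= G) by (apply rsum_ge0; intros; apply pow2_ge_0).
  assert (HM : 0 <= M).
  { apply le_epsilon; intros eps He. destruct (H eps He) as [K HK].
    eapply Rle_trans; [apply Cmod_ge_0|apply (HK K 0); lia]. }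
  assert (Key : forall eps, 0 < eps -> rsum N (fun m => Cmod (conv c g m) ^ 2) <= (M + eps) ^ 2 * G).
  { intros eps He. destruct (Nat.eq_dec N 0) as [->|HN]; [unfold G; simpl; lra|].
    (* [K >= N] keeps the first [N] coefficients of the product intact, and [L = K + N] exceeds the
       degree of the product of the truncations, so evaluation at the [L]-th roots of unity loses
       nothing. *)
    destruct (H eps He) as [K0 HK]. set (K := (K0 + N)%nat). set (L := (K + N)%nat).
    set (gN := fun i => if (i <? N)%nat then g i else RtoC 0).
    (* The guard [i <=? m] discards the indices where the truncated difference [m - i] would wrongly
       return 0. *)
    set (q := fun m => csum K (fun i => c i * (if (i <=? m)%nat then gN (m - i)%nat else RtoC 0))%C).
    assert (HL : (0 < L)%nat) by (unfold L; lia).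
    assert (P := finite_parseval L q HL). assert (Q := finite_parseval L gN HL).
    set (w := 2 * PI / INR L) in *.
    assert (E : forall t, csum L (fun m => q m * cis t ^ m)%C =
       (csum K (fun n => c n * cis t ^ n) * csum L (fun m => gN m * cis t ^ m))%C).
    { intros t. unfold q.
      rewrite (csum_ext L _ (fun m => csum K (fun i => c i * (if (i <=? m)%nat then gN (m - i)%nat else RtoC 0) * cis t ^ m)%C))
        by (intros; now rewrite csum_scal_r).
      rewrite csum_swap, <- csum_scal_r. apply csum_ext; intros i Hi.
      replace L with (i + (L - i))%nat by lia. rewrite csum_add, csum_0.
      2:{ intros j Hj. destruct (Nat.leb_spec i j); [lia|ring]. }
      replace (i + (L - i))%nat with L by lia.
      rewrite (csum_trunc (L - i) L); [|lia|].
      2:{ intros j Hj. unfold gN. destruct (Nat.ltb_spec j N); [unfold L in *; lia|ring]. }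
      rewrite <- csum_scal, Cplus_0_l. apply csum_ext; intros j _.
      destruct (Nat.leb_spec i (i + j)); [|lia].
      replace (i + j - i)%nat with j by lia. rewrite Cpow_add_r. ring. }
    assert (C1 : INR L * rsum L (fun m => Cmod (q m) ^ 2) <=
       (M + eps) ^ 2 * (INR L * rsum L (fun m => Cmod (gN m) ^ 2))).
    { rewrite <- P, <- Q, <- rsum_scal. apply rsum_le; intros j _.
      rewrite E, Cmod_mult, Rpow_mult_distr. apply Rmult_le_compat_r; [apply pow2_ge_0|].
      apply pow_incr. split; [apply Cmod_ge_0|]. apply HK. unfold K; lia. }
    assert (HL' : 0 < INR L) by now apply lt_0_INR.
    assert (C2 : rsum L (fun m => Cmod (q m) ^ 2) <= (M + eps) ^ 2 * rsum L (fun m => Cmod (gN m) ^ 2)).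
    { apply Rmult_le_reg_l with (INR L); trivial. lra. }
    replace G with (rsum L (fun m => Cmod (gN m) ^ 2)).
    2:{ replace L with (N + K)%nat by (unfold L; lia). rewrite rsum_add.
        rewrite (rsum_ext K _ (fun _ => 0)), rsum_const, Rmult_0_r, Rplus_0_r.
        - apply rsum_ext; intros i Hi. unfold gN. destruct (Nat.ltb_spec i N); [easy|lia].
        - intros i _. unfold gN. destruct (Nat.ltb_spec (N + i) N); [lia|]. rewrite Cmod_0; ring. }
    eapply Rle_trans; [|exact C2].
    eapply Rle_trans; [|apply (rsum_mono N L); [intros; apply pow2_ge_0|unfold L; lia]].
    apply Req_le, rsum_ext; intros m Hm. do 2 f_equal. unfold conv, q.
    rewrite (csum_trunc (S m) K).
    - apply csum_ext; intros i Hi. destruct (Nat.leb_spec i m); [|lia].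
      unfold gN. destruct (Nat.ltb_spec (m - i) N); [easy|lia].
    - unfold K; lia.
    - intros i Hi. destruct (Nat.leb_spec i m); [lia|ring]. }
  apply le_epsilon; intros eps He.
  (* For [d <= 1] the excess of [(M + d)^2 G] over [M^2 G] is at most [d (2 M + 1) G], which the
     second bound on [d] makes at most [eps]. *)
  set (d := Rmin 1 (eps / ((2 * M + 1) * (G + 1)))).
  assert (P : 0 < (2 * M + 1) * (G + 1)) by nra.
  assert (Hd : 0 < d) by (apply Rmin_pos; [lra|now apply Rdiv_lt_0_compat]).
  specialize (Key d Hd).
  assert (D1 : d <= 1) by apply Rmin_l.
  assert (D2 : d * ((2 * M + 1) * (G + 1)) <= eps).
  { apply Rle_trans with (eps / ((2 * M + 1) * (G + 1)) * ((2 * M + 1) * (G + 1))).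
    - apply Rmult_le_compat_r; [lra|apply Rmin_r].
    - right; field; nra. }
  assert (d * d <= d) by nra.
  assert (d * d * G <= d * G) by (apply Rmult_le_compat_r; lra).
  assert (0 <= d * (2 * M + 1)) by nra.
  nra.
Qed.

(** * Series and power series *)

(** Partial sums here have [n] terms, whereas [sum_n u n] has [n + 1]; this explains the index
    shifts in the comparison below. *)
Definition csums (u : nat -> C) (l : C) : Prop :=
  forall eps, 0 < eps -> exists N, forall n, (N <= n)%nat -> Cmod (csum n u - l) < eps.

Lemma sum_n_csum (u : nat -> C) n : @sum_n C_AbelianMonoid u n = csum (S n) u.
Proof.
  induction n.
  - rewrite sum_O. simpl. ring.
  - now rewrite sum_Sn, IHn.
Qed.

Lemma csums_is_series u l : csums u l <-> @is_series C_AbsRing C_NormedModule u l.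
Proof.
  unfold is_series. rewrite (@filterlim_locally_ball_norm C_AbsRing nat C_NormedModule eventually _ (sum_n u) l). split.
  - intros H eps. destruct (H eps (cond_pos eps)) as [N HN]. exists N; intros n L.
    unfold ball_norm. change (Cmod (sum_n u n - l) < eps).
    rewrite sum_n_csum. apply HN; lia.
  - intros H eps He. destruct (H (mkposreal eps He)) as [N HN]. exists (S N); intros n L.
    destruct n; [lia|]. rewrite <- sum_n_csum. apply (HN n). lia.
Qed.

Lemma pow_n_Cpow (z : C) n : @pow_n C_Ring z n = (z ^ n)%C.
Proof. induction n; simpl; now rewrite ?IHn. Qed.

Lemma csums_ext u v l : (forall n, u n = v n) -> csums u l -> csums v l.
Proof.
  intros E H eps He. destruct (H eps He) as [N HN]. exists N; intros n L.
  rewrite <- (csum_ext n u v); auto.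
Qed.

Definition ps (a : nat -> C) (z l : C) : Prop := csums (fun n => a n * z ^ n)%C l.

Lemma ps_is_pseries a z l : ps a z l <-> @is_pseries C_AbsRing C_NormedModule a z l.
Proof.
  unfold ps, is_pseries. rewrite csums_is_series.
  assert (E : forall n, (a n * z ^ n)%C = @scal C_Ring C_ModuleSpace (@pow_n C_Ring z n) (a n)).
  { intros n. transitivity (z ^ n * a n)%C; [ring|]. now rewrite <- (pow_n_Cpow z n). }
  split; apply is_series_ext; intros n; [apply E|symmetry; apply E].
Qed.

Lemma csums_le u l B : csums u l -> (exists N, forall n, (N <= n)%nat -> Cmod (csum n u) <= B) -> Cmod l <= B.
Proof.
  intros H [N0 H0]. apply le_epsilon; intros eps He.
  destruct (H eps He) as [N HN]. set (n := (N + N0)%nat).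
  specialize (HN n ltac:(lia)). specialize (H0 n ltac:(lia)).
  replace l with (csum n u + - (csum n u - l))%C by ring.
  eapply Rle_trans; [apply Cmod_triangle|]. rewrite Cmod_opp. lra.
Qed.

Lemma csums_plus u v l m : csums u l -> csums v m -> csums (fun n => u n + v n)%C (l + m)%C.
Proof.
  intros H1 H2 eps He. destruct (H1 (eps / 2)) as [N1 L1]; [lra|].
  destruct (H2 (eps / 2)) as [N2 L2]; [lra|]. exists (N1 + N2)%nat; intros n L.
  rewrite csum_plus. replace (_ - _)%C with ((csum n u - l) + (csum n v - m))%C by ring.
  eapply Rle_lt_trans; [apply Cmod_triangle|].
  specialize (L1 n ltac:(lia)); specialize (L2 n ltac:(lia)); lra.
Qed.

Lemma csums_scal a u l : csums u l -> csums (fun n => a * u n)%C (a * l)%C.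
Proof.
  intros H eps He. assert (P := Cmod_ge_0 a).
  destruct (H (eps / (Cmod a + 1))) as [N L]; [apply Rdiv_lt_0_compat; lra|].
  exists N; intros n Hn. rewrite csum_scal.
  replace (_ - _)%C with (a * (csum n u - l))%C by ring. rewrite Cmod_mult.
  specialize (L n Hn). apply Rle_lt_trans with (Cmod a * (eps / (Cmod a + 1))).
  - apply Rmult_le_compat_l; lra.
  - apply Rmult_lt_reg_r with (Cmod a + 1); [lra|].
    replace (Cmod a * (eps / (Cmod a + 1)) * (Cmod a + 1)) with (Cmod a * eps) by (field; lra). nra.
Qed.

Lemma csums_minus u v l m : csums u l -> csums v m -> csums (fun n => u n - v n)%C (l - m)%C.
Proof.
  intros H1 H2. apply (csums_scal (RtoC (-1))) in H2.
  generalize (csums_plus _ _ _ _ H1 H2).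
  replace (l + RtoC (-1) * m)%C with (l - m)%C by (apply injective_projections; simpl; ring).
  apply csums_ext; intros n. apply injective_projections; simpl; ring.
Qed.

Lemma csums_fin N u : (forall n, (N <= n)%nat -> u n = RtoC 0) -> csums u (csum N u).
Proof.
  intros H eps He. exists N; intros n L.
  rewrite (csum_trunc N n) by (trivial; intros; apply H; lia).
  replace (_ - _)%C with (RtoC 0) by ring. now rewrite Cmod_0.
Qed.

Lemma csums_unique u l m : csums u l -> csums u m -> l = m.
Proof.
  intros H1 H2. apply Ceq_minus, Cmod_eq_0, Rle_antisym; [|apply Cmod_ge_0].
  apply (csums_le _ _ _ (csums_minus _ _ _ _ H1 H2)). exists 0%nat; intros n _.
  rewrite csum_0; [rewrite Cmod_0; lra|]. intros; ring.
Qed.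

Lemma csums_shift k u l : csums u l ->
  csums (fun n => if (k <=? n)%nat then u (n - k)%nat else RtoC 0) l.
Proof.
  intros H eps He. destruct (H eps He) as [N L]. exists (k + N)%nat; intros n Hn.
  replace n with (k + (n - k))%nat by lia. rewrite csum_add, csum_0.
  2:{ intros i Hi. destruct (Nat.leb_spec k i); [lia|easy]. }
  rewrite Cplus_0_l. rewrite (csum_ext _ _ u); [apply L; lia|].
  intros i _. destruct (Nat.leb_spec k (k + i)); [f_equal; lia|lia].
Qed.

Lemma csums_csum J (v : nat -> nat -> C) W :
  (forall j, (j < J)%nat -> csums (fun n => v n j) (W j)) ->
  csums (fun n => csum J (v n)) (csum J W).
Proof.
  induction J; intros H; simpl.
  - apply (csums_fin 0); trivial.
  - apply (csums_plus (fun n => csum J (v n)) (fun n => v n J)).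
    + apply IHJ; intros; apply H; lia.
    + apply H; lia.
Qed.

Lemma sum_n_rsum (u : nat -> R) n : sum_n u n = rsum (S n) u.
Proof.
  induction n.
  - rewrite sum_O. simpl. ring.
  - now rewrite sum_Sn, IHn.
Qed.

Lemma bounded_ex_series A B :
  (forall n, 0 <= A n) -> (forall n, rsum n A <= B) -> ex_series A /\ Series A <= B.
Proof.
  intros P H.
  assert (E : ex_series A).
  { destruct (ex_finite_lim_seq_incr (sum_n A) B) as [l Hl].
    - intros n. rewrite sum_Sn. change (sum_n A n <= sum_n A n + A (S n)). specialize (P (S n)). lra.
    - intros n. rewrite sum_n_rsum. apply H.
    - exists l. exact Hl. }
  split; trivial. apply Series_correct in E.
  apply (is_lim_seq_le (sum_n A) (fun _ => B) (Series A) B); [|exact E|apply is_lim_seq_const].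
  intros n. rewrite sum_n_rsum. apply H.
Qed.

Lemma rsum_le_Series A n : (forall n, 0 <= A n) -> ex_series A -> rsum n A <= Series A.
Proof.
  intros P E. apply Series_correct in E.
  assert (L : is_lim_seq (sum_n A) (Series A)) by exact E.
  apply Rle_trans with (sum_n A n).
  - rewrite sum_n_rsum. apply rsum_mono; auto.
  - apply (is_lim_seq_incr_compare _ _ L). intros m. rewrite sum_Sn.
    change (sum_n A m <= sum_n A m + A (S m)). specialize (P (S m)). lra.
Qed.

Lemma bounded_tail A B : (forall n, 0 <= A n) -> (forall n, rsum n A <= B) ->
  forall eps, 0 < eps -> exists N, forall n, (N <= n)%nat -> rsum n A <= rsum N A + eps.
Proof.
  intros P H eps He. destruct (bounded_ex_series A B P H) as [E _].
  assert (L : is_lim_seq (sum_n A) (Series A)) by (apply Series_correct in E; exact E).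
  apply is_lim_seq_spec in L. destruct (L (mkposreal eps He)) as [N HN].
  specialize (HN N ltac:(lia)); simpl in HN. rewrite sum_n_rsum in HN.
  exists (S N); intros n Hn. generalize (rsum_le_Series A n P E).
  apply Rabs_def2 in HN. lra.
Qed.

(** The threshold [N] is read off the majorant [A] alone; hence the estimate is uniform over all
    series dominated by [A], such as a power series on a circle. *)
Lemma csums_tail u l A N eps : csums u l -> (forall n, Cmod (u n) <= A n) ->
  (forall n, (N <= n)%nat -> rsum n A <= rsum N A + eps) ->
  forall k, (N <= k)%nat -> Cmod (csum k u - l) <= eps.
Proof.
  intros H HA HN k Hk.
  assert (D : csums (fun n => if (k <=? n)%nat then u n else RtoC 0) (l - csum k u)%C).
  { intros e He. destruct (H e He) as [K HK]. exists (k + K)%nat; intros n Hn.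
    specialize (HK n ltac:(lia)).
    replace (csum n (fun i => if (k <=? i)%nat then u i else RtoC 0)) with (csum n u - csum k u)%C.
    - now replace (csum n u - csum k u - (l - csum k u))%C with (csum n u - l)%C by ring.
    - replace n with (k + (n - k))%nat by lia. rewrite !csum_add.
      rewrite (csum_0 k (fun i => if (k <=? i)%nat then u i else RtoC 0)).
      2:{ intros i Hi. destruct (Nat.leb_spec k i); [lia|easy]. }
      rewrite (csum_ext (n - k) (fun i => if (k <=? k + i)%nat then u (k + i)%nat else RtoC 0) (fun i => u (k + i)%nat)).
      2:{ intros i Hi. destruct (Nat.leb_spec k (k + i)); [easy|lia]. }
      ring. }
  rewrite <- Cmod_opp. replace (- (csum k u - l))%C with (l - csum k u)%C by ring.
  apply (csums_le _ _ _ D). exists k; intros n Hn.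
  replace n with (k + (n - k))%nat by lia. rewrite csum_add, csum_0, Cplus_0_l.
  2:{ intros i Hi. destruct (Nat.leb_spec k i); [lia|easy]. }
  eapply Rle_trans; [apply csum_mod|].
  apply Rle_trans with (rsum (n - k) (fun i => A (k + i)%nat)).
  - apply rsum_le; intros i _. destruct (Nat.leb_spec k (k + i)); [apply HA|lia].
  - specialize (HN n ltac:(lia)). replace n with (k + (n - k))%nat in HN by lia.
    rewrite rsum_add in HN.
    assert (rsum N A <= rsum k A).
    { apply rsum_mono; trivial. intros i. eapply Rle_trans; [apply Cmod_ge_0|apply HA]. }
    lra.
Qed.

Lemma abs_csums u B : (forall n, rsum n (fun i => Cmod (u i)) <= B) -> exists l, csums u l.
Proof.
  intros H. destruct (bounded_ex_series (fun i => Cmod (u i)) B) as [E _]; trivial.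
  { intros; apply Cmod_ge_0. }
  destruct (@ex_series_le C_AbsRing C_CompleteNormedModule u (fun i => Cmod (u i))) as [l Hl]; trivial.
  - intros n. apply Rle_refl.
  - exists l. now apply csums_is_series.
Qed.

Lemma rsum_lim0 N (f : nat -> nat -> R) :
  (forall n eps, 0 < eps -> exists J0, forall J, (J0 <= J)%nat -> f n J < eps) ->
  forall eps, 0 < eps -> exists J0, forall J, (J0 <= J)%nat -> rsum N (fun n => f n J) < eps.
Proof.
  intros H. induction N; intros eps He; simpl.
  - now exists 0%nat.
  - destruct (IHN (eps / 2)) as [J1 H1]; [lra|]. destruct (H N (eps / 2)) as [J2 H2]; [lra|].
    exists (J1 + J2)%nat; intros J L. specialize (H1 J ltac:(lia)); specialize (H2 J ltac:(lia)). lra.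
Qed.

(* Tannery's theorem: [A] dominates the partial row sums uniformly in the number of columns. *)
Lemma csums_exchange (v : nat -> nat -> C) V W A B S :
  (forall n j, Cmod (csum j (v n)) <= A n) -> (forall n, rsum n A <= B) ->
  (forall n, csums (v n) (V n)) -> (forall j, csums (fun n => v n j) (W j)) ->
  csums V S -> csums W S.
Proof.
  intros HA HB HV HW HS eps He.
  assert (PA : forall n, 0 <= A n) by (intros n; eapply Rle_trans; [apply Cmod_ge_0|apply (HA n 0%nat)]).
  assert (VA : forall n, Cmod (V n) <= A n).
  { intros n. apply (csums_le _ _ _ (HV n)). exists 0%nat; intros; apply HA. }
  destruct (bounded_tail A B PA HB (eps / 5)) as [N HN]; [lra|].
  destruct (rsum_lim0 N (fun n J => Cmod (csum J (v n) - V n)) (fun n e h => HV n e h) (eps / 5)) as [J0 HJ]; [lra|].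
  exists J0; intros J L.
  assert (D : csums (fun n => csum J (v n) - V n)%C (csum J W - S)%C).
  { apply csums_minus; trivial. apply csums_csum; auto. }
  apply Rle_lt_trans with (3 * (eps / 5)); [|lra].
  apply (csums_le _ _ _ D). exists N; intros m Hm.
  eapply Rle_trans; [apply csum_mod|].
  specialize (HN m Hm). replace m with (N + (m - N))%nat in HN |- * by lia.
  rewrite rsum_add in *. specialize (HJ J L).
  assert (rsum (m - N) (fun i => Cmod (csum J (v (N + i)%nat) - V (N + i)%nat)) <=
          rsum (m - N) (fun i => 2 * A (N + i)%nat)).
  { apply rsum_le; intros i _. unfold Cminus. eapply Rle_trans; [apply Cmod_triangle|].
    rewrite Cmod_opp. specialize (HA (N + i)%nat J); specialize (VA (N + i)%nat). lra. }
  rewrite rsum_scal in H. lra.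
Qed.

Lemma rsum_shift_abs k n u : rsum n (fun j => Cmod (if (k <=? j)%nat then u (j - k)%nat else RtoC 0)) <=
  rsum n (fun i => Cmod (u i)).
Proof.
  destruct (Nat.le_gt_cases n k) as [L|L].
  - apply rsum_le; intros i Hi. destruct (Nat.leb_spec k i); [lia|]. rewrite Cmod_0; apply Cmod_ge_0.
  - replace n with (k + (n - k))%nat at 1 by lia. rewrite rsum_add.
    rewrite (rsum_ext k _ (fun _ => 0)), rsum_const.
    2:{ intros i Hi. destruct (Nat.leb_spec k i); [lia|]. apply Cmod_0. }
    rewrite (rsum_ext (n - k) _ (fun i => Cmod (u i))).
    + rewrite Rmult_0_r, Rplus_0_l. apply rsum_mono; [intros; apply Cmod_ge_0|lia].
    + intros i _. destruct (Nat.leb_spec k (k + i)); [do 2 f_equal; lia|lia].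
Qed.

(** Exchange of summation in the array [c_i g_(m-i)]: row [i] is [g] delayed by [i] places and sums
    to [c_i T], while column [m] is finite and sums to [conv c g m]. *)
Lemma csums_conv c g S T Bc Bg : (forall n, rsum n (fun i => Cmod (c i)) <= Bc) ->
  (forall n, rsum n (fun i => Cmod (g i)) <= Bg) -> csums c S -> csums g T ->
  csums (conv c g) (S * T)%C.
Proof.
  intros Hc Hg HS HT.
  assert (0 <= Bg) by apply (Hg 0%nat).
  apply (csums_exchange (fun i m => if (i <=? m)%nat then c i * g (m - i)%nat else RtoC 0)%C
     (fun i => c i * T)%C _ (fun i => Cmod (c i) * Bg) (Bc * Bg)).
  - intros i m. eapply Rle_trans; [apply csum_mod|].
    rewrite (rsum_ext m _ (fun j => Cmod (c i) * Cmod (if (i <=? j)%nat then g (j - i)%nat else RtoC 0))).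
    + rewrite rsum_scal. apply Rmult_le_compat_l; [apply Cmod_ge_0|].
      eapply Rle_trans; [apply rsum_shift_abs|apply Hg].
    + intros j _. destruct (i <=? j)%nat; [apply Cmod_mult|]. rewrite Cmod_0; ring.
  - intros n. rewrite (rsum_ext n _ (fun i => Bg * Cmod (c i))) by (intros; ring).
    rewrite rsum_scal, Rmult_comm. now apply Rmult_le_compat_r.
  - intros i. apply (csums_shift i), (csums_scal (c i)) in HT. revert HT.
    apply csums_ext; intros m. destruct (i <=? m)%nat; ring.
  - intros m. unfold conv.
    rewrite (csum_ext (Datatypes.S m) _ (fun i => if (i <=? m)%nat then c i * g (m - i)%nat else RtoC 0)%C).
    + apply csums_fin. intros n Hn. destruct (Nat.leb_spec n m); [lia|easy].
    + intros i Hi. destruct (Nat.leb_spec i m); [easy|lia].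
  - apply (csums_scal T) in HS. rewrite Cmult_comm. revert HS.
    apply csums_ext; intros; ring.
Qed.

Lemma conv_pow c g (z : C) m :
  conv (fun n => c n * z ^ n)%C (fun n => g n * z ^ n)%C m = (conv c g m * z ^ m)%C.
Proof.
  unfold conv. rewrite <- csum_scal_r. apply csum_ext; intros i Hi.
  replace (z ^ m)%C with (z ^ i * z ^ (m - i))%C by (rewrite <- Cpow_add_r; f_equal; lia). ring.
Qed.

Lemma rsum_geom_le q n : 0 <= q < 1 -> rsum n (pow q) <= / (1 - q).
Proof.
  intros H. assert (E : rsum n (pow q) * (1 - q) = 1 - q ^ n)
    by (induction n; simpl; [ring|]; rewrite Rmult_plus_distr_r, IHn; ring).
  assert (0 <= q ^ n) by now apply pow_le.
  apply Rmult_le_reg_r with (1 - q); [lra|]. rewrite E, Rinv_l by lra. lra.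
Qed.

(** Abel's lemma: the terms are dominated by a geometric progression of ratio [r / tau]. *)
Lemma bounded_terms_abs a K tau r : (forall n, Cmod (a n) * tau ^ n <= K) -> 0 <= r < tau ->
  forall n, rsum n (fun i => Cmod (a i) * r ^ i) <= K * / (1 - r / tau).
Proof.
  intros H Hr n.
  assert (0 <= K) by (eapply Rle_trans; [|apply (H 0%nat)]; simpl; rewrite Rmult_1_r; apply Cmod_ge_0).
  assert (Q : 0 <= r / tau < 1).
  { split; [apply Rmult_le_pos; [lra|left; apply Rinv_0_lt_compat; lra]|].
    apply Rmult_lt_reg_r with tau; [lra|]. unfold Rdiv.
    rewrite Rmult_assoc, Rinv_l by lra. lra. }
  apply Rle_trans with (rsum n (fun i => K * (r / tau) ^ i)).
  - apply rsum_le; intros i _. replace (Cmod (a i) * r ^ i) with (Cmod (a i) * tau ^ i * (r / tau) ^ i).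
    + apply Rmult_le_compat_r; [now apply pow_le|apply H].
    + unfold Rdiv. rewrite Rpow_mult_distr, pow_inv.
      field. apply pow_nonzero. lra.
  - rewrite rsum_scal. apply Rmult_le_compat_l; trivial. now apply rsum_geom_le.
Qed.

Lemma ps_abs a z l r : ps a z l -> 0 <= r < Cmod z ->
  exists B, forall n, rsum n (fun i => Cmod (a i) * r ^ i) <= B.
Proof.
  intros H Hr. destruct (H 1) as [N HN]; [lra|].
  set (u := fun n => (a n * z ^ n)%C) in *.
  (* Past [N] a term is the difference of two partial sums within 1 of the limit; before [N] it is
     one of the finitely many terms summed. *)
  assert (K : forall n, Cmod (u n) <= 2 + rsum N (fun i => Cmod (u i))).
  { intros n. destruct (Nat.le_gt_cases N n).
    - assert (0 <= rsum N (fun i => Cmod (u i))) by (apply rsum_ge0; intros; apply Cmod_ge_0).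
      assert (L1 := HN n ltac:(lia)). assert (L2 := HN (S n) ltac:(lia)).
      replace (u n) with ((csum (S n) u - l) + - (csum n u - l))%C by (simpl; ring).
      eapply Rle_trans; [apply Cmod_triangle|]. rewrite Cmod_opp. lra.
    - assert (Cmod (u n) <= rsum N (fun i => Cmod (u i)))
        by (apply (rsum_term_le N n (fun i => Cmod (u i))); trivial; intros; apply Cmod_ge_0). lra. }
  set (K0 := 2 + _) in K. exists (K0 * / (1 - r / Cmod z)).
  apply bounded_terms_abs; [|exact Hr].
  intros n. rewrite <- Cmod_pow, <- Cmod_mult. apply K.
Qed.

(** * Convergence in a disk and estimates on circles *)

Definition converges_within (a : nat -> C) (R0 : R) : Prop :=
  forall z, Cmod z < R0 -> exists l, ps a z l.

Lemma converges_abs a R0 r : converges_within a R0 -> 0 <= r < R0 ->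
  exists B, forall n, rsum n (fun i => Cmod (a i) * r ^ i) <= B.
Proof.
  intros H Hr. assert (E : Cmod (RtoC ((r + R0) / 2)) = (r + R0) / 2)
    by (rewrite Cmod_R; apply Rabs_pos_eq; lra).
  destruct (H (RtoC ((r + R0) / 2))) as [l Hl]; [lra|].
  apply (ps_abs _ _ _ _ Hl). lra.
Qed.

Lemma rsum_ps_abs a z n :
  rsum n (fun i => Cmod (a i * z ^ i)) = rsum n (fun i => Cmod (a i) * Cmod z ^ i).
Proof. apply rsum_ext; intros. now rewrite Cmod_mult, Cmod_pow. Qed.

Lemma abs_ps a z r B : (forall n, rsum n (fun i => Cmod (a i) * r ^ i) <= B) -> Cmod z <= r ->
  exists l, ps a z l.
Proof.
  intros H Hz. apply (abs_csums _ B); intros n. rewrite rsum_ps_abs.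
  eapply Rle_trans; [|apply (H n)]. apply rsum_le; intros i _.
  apply Rmult_le_compat_l; [apply Cmod_ge_0|]. apply pow_incr; split; [apply Cmod_ge_0|trivial].
Qed.

(** Rescaling by [r^n] reduces the circle of radius [r] to the unit circle. Absolute convergence
    there, due to [r < R0], brings the partial sums within [eps] of the values uniformly in the
    angle, as the contraction lemma requires. *)
Lemma toeplitz_circle c g M N R0 r : 0 <= r < R0 -> converges_within c R0 ->
  (forall z l, Cmod z = r -> ps c z l -> Cmod l <= M) ->
  rsum N (fun m => Cmod (conv c g m * r ^ m) ^ 2) <=
  M ^ 2 * rsum N (fun m => Cmod (g m * r ^ m) ^ 2).
Proof.
  intros Hr Hc HM. destruct (converges_abs c R0 r Hc Hr) as [B HB].
  assert (T := toeplitz_contraction (fun n => c n * r ^ n)%C (fun n => g n * r ^ n)%C M N).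
  rewrite (rsum_ext N _ (fun m => Cmod (conv (fun n => c n * r ^ n)%C (fun n => g n * r ^ n)%C m) ^ 2))
    by (intros; now rewrite conv_pow).
  apply T. intros eps He.
  destruct (bounded_tail (fun i => Cmod (c i) * r ^ i) B) with (eps := eps) as [K HK]; trivial.
  { intros; apply Rmult_le_pos; [apply Cmod_ge_0|apply pow_le; lra]. }
  exists K; intros k t Hk.
  assert (Ez : Cmod (r * cis t) = r) by (rewrite Cmod_mult, cis_mod, Cmod_R, Rabs_pos_eq by lra; ring).
  destruct (Hc (r * cis t)%C) as [l Hl]; [lra|].
  assert (Hm := HM _ _ Ez Hl).
  assert (Hd : Cmod (csum k (fun n => c n * (r * cis t) ^ n)%C - l) <= eps).
  { apply (csums_tail _ _ (fun i => Cmod (c i) * r ^ i) K); trivial.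
    intros n. rewrite Cmod_mult, Cmod_pow, Ez. lra. }
  rewrite (csum_ext k _ (fun n => c n * (r * cis t) ^ n)%C) by (intros; rewrite Cpow_mult_l; ring).
  replace (csum k _) with ((csum k (fun n => c n * (r * cis t) ^ n) - l) + l)%C by ring.
  eapply Rle_trans; [apply Cmod_triangle|]. lra.
Qed.

(** Coefficients of the monomial [z^n]. *)
Definition delta (n m : nat) : C := RtoC (if Nat.eq_dec m n then 1 else 0).

Lemma conv_delta0 c m : conv c (delta 0) m = c m.
Proof.
  unfold conv. simpl. rewrite csum_0.
  - unfold delta. rewrite Nat.sub_diag. destruct (Nat.eq_dec 0 0); [ring|lia].
  - intros i Hi. unfold delta. destruct (Nat.eq_dec (m - i) 0); [lia|ring].
Qed.

(** The multiplication bound is applied to the constant 1: the product has the terms [c_m r^m], and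
    a sum of squares dominates each of its terms. *)
Lemma cauchy_estimate c M R0 r n : 0 <= r < R0 -> converges_within c R0 ->
  (forall z l, Cmod z = r -> ps c z l -> Cmod l <= M) -> Cmod (c n) * r ^ n <= M.
Proof.
  intros Hr Hc HM.
  assert (M0 : 0 <= M).
  { destruct (Hc (RtoC r)) as [l Hl]; [rewrite Cmod_R, Rabs_pos_eq; lra|].
    eapply Rle_trans; [apply Cmod_ge_0|apply (HM (RtoC r) l); trivial].
    rewrite Cmod_R, Rabs_pos_eq; lra. }
  assert (T := toeplitz_circle c (delta 0) M (S n) R0 r Hr Hc HM).
  assert (E : rsum (S n) (fun m => Cmod (delta 0 m * r ^ m) ^ 2) = 1).
  { replace 1 with (1 + INR n * 0) by ring. rewrite <- (rsum_const n).
    change (S n) with (1 + n)%nat. rewrite rsum_add. f_equal.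
    - simpl. unfold delta; simpl. rewrite !Cmult_1_r, Cmod_1; ring.
    - apply rsum_ext; intros i _. unfold delta; simpl. rewrite Cmult_0_l, Cmod_0; ring. }
  rewrite E, Rmult_1_r in T.
  assert (P := rsum_term_le (S n) n (fun m => Cmod (conv c (delta 0) m * r ^ m) ^ 2)
     (fun _ => pow2_ge_0 _) ltac:(lia)).
  cbv beta in P. assert (Q := Rle_trans _ _ _ P T).
  rewrite conv_delta0, Cmod_mult, <- RtoC_pow, Cmod_R, Rabs_pos_eq in Q by (apply pow_le; lra).
  apply Rsqr_incr_0_var; trivial. now rewrite !Rsqr_pow2.
Qed.

(** Cauchy's estimate with bound 0, for the difference of the two series. *)
Lemma ps_unique a b R0 : 0 < R0 ->
  (forall z, Cmod z < R0 -> exists l, ps a z l /\ ps b z l) -> forall n, a n = b n.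
Proof.
  intros HR H n. set (d := fun n => (a n - b n)%C).
  assert (D : forall z, Cmod z < R0 -> ps d z 0).
  { intros z Hz. destruct (H z Hz) as [l [H1 H2]].
    generalize (csums_minus _ _ _ _ H1 H2). replace (l - l)%C with (RtoC 0) by ring.
    apply csums_ext; intros; unfold d; ring. }
  assert (E := cauchy_estimate d 0 R0 (R0 / 2) n ltac:(lra)
    (fun z Hz => ex_intro _ _ (D z Hz))).
  assert (Cmod (d n) * (R0 / 2) ^ n <= 0).
  { apply E. intros z l Hz Hl. rewrite (csums_unique _ _ _ Hl (D z ltac:(lra))), Cmod_0. lra. }
  assert (0 < (R0 / 2) ^ n) by (apply pow_lt; lra).
  apply Ceq_minus, Cmod_eq_0, Rle_antisym; [|apply Cmod_ge_0]. fold (d n). nra.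
Qed.

Lemma bernoulli x n : 0 <= x <= 1 -> 1 - INR n * x <= (1 - x) ^ n.
Proof.
  intros H. induction n; [simpl; lra|]. rewrite S_INR. simpl.
  assert (0 <= INR n) by apply pos_INR. nra.
Qed.

Definition maps_disk (c : nat -> C) : Prop :=
  forall z, Cmod z < 1 -> exists l, ps c z l /\ Cmod l <= 1.

(** The multiplication bound holds on each circle of radius [r < 1]; for [m < N] the weights
    [r^(2m)] lie between [r^(2N)] and 1, and [r] tends to 1. *)
Lemma maps_disk_toeplitz c g N : maps_disk c ->
  rsum N (fun m => Cmod (conv c g m) ^ 2) <= rsum N (fun m => Cmod (g m) ^ 2).
Proof.
  intros H. set (X := rsum N _). set (Y := rsum N (fun m => Cmod (g m) ^ 2)).
  assert (HX : 0 <= X) by (apply rsum_ge0; intros; apply pow2_ge_0).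
  assert (Key : forall r, 0 <= r < 1 -> r ^ (2 * N) * X <= Y).
  { intros r Hr.
    assert (T : rsum N (fun m => Cmod (conv c g m * r ^ m) ^ 2) <=
       1 ^ 2 * rsum N (fun m => Cmod (g m * r ^ m) ^ 2)).
    { apply (toeplitz_circle c g 1 N 1 r Hr).
      - intros z Hz. destruct (H z Hz) as [l Hl]. exists l; tauto.
      - intros z l Hz Hl. destruct (H z ltac:(lra)) as [l' [Hl' B]].
        now rewrite (csums_unique _ _ _ Hl Hl'). }
    unfold X, Y. rewrite <- rsum_scal.
    assert (E : forall u m, Cmod (u * r ^ m) ^ 2 = r ^ (2 * m) * Cmod u ^ 2).
    { intros. rewrite Cmod_mult, <- RtoC_pow, Cmod_R, Rabs_pos_eq, Rpow_mult_distr by (apply pow_le; lra).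
      rewrite pow_mult, <- !pow_mult, (Nat.mul_comm m 2). ring. }
    eapply Rle_trans; [|eapply Rle_trans; [exact T|]].
    - apply rsum_le; intros m Hm. rewrite E. apply Rmult_le_compat_r; [apply pow2_ge_0|].
      replace (2 * N)%nat with (2 * m + 2 * (N - m))%nat by lia. rewrite pow_add.
      rewrite <- (Rmult_1_r (r ^ (2 * m))) at 2. apply Rmult_le_compat_l; [apply pow_le; lra|].
      rewrite <- (pow1 (2 * (N - m))). apply pow_incr; lra.
    - rewrite pow1, Rmult_1_l. apply rsum_le; intros m Hm. rewrite E.
      rewrite <- (Rmult_1_l (Cmod (g m) ^ 2)) at 2. apply Rmult_le_compat_r; [apply pow2_ge_0|].
      rewrite <- (pow1 (2 * m)). apply pow_incr; lra. }
  apply le_epsilon; intros eps He.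
  (* The radius is [r = 1 - d]; Bernoulli's inequality gives [r^(2N) >= 1 - n d], and [d] makes the
     loss [n d X] at most [eps]. *)
  set (n := INR (2 * N)). assert (0 <= n) by apply pos_INR.
  set (d := Rmin 1 (eps / ((n + 1) * (X + 1)))).
  assert (P : 0 < (n + 1) * (X + 1)) by nra.
  assert (Hd : 0 < d) by (apply Rmin_pos; [lra|now apply Rdiv_lt_0_compat]).
  assert (D1 : d <= 1) by apply Rmin_l.
  assert (D2 : d * ((n + 1) * (X + 1)) <= eps).
  { apply Rle_trans with (eps / ((n + 1) * (X + 1)) * ((n + 1) * (X + 1))).
    - apply Rmult_le_compat_r; [lra|apply Rmin_r].
    - right; field; nra. }
  specialize (Key (1 - d) ltac:(lra)).
  assert (Bn := bernoulli d (2 * N) ltac:(lra)). fold n in Bn.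
  assert ((1 - n * d) * X <= (1 - d) ^ (2 * N) * X) by now apply Rmult_le_compat_r.
  assert (0 <= d * n) by nra. assert (0 <= d * X) by nra. nra.
Qed.

(** * Expansion on the disk *)

Lemma bounded_terms_converge a K tau : (forall n, Cmod (a n) * tau ^ n <= K) -> converges_within a tau.
Proof.
  intros H z Hz. assert (P := Cmod_ge_0 z).
  apply (abs_ps a z (Cmod z) (K * / (1 - Cmod z / tau))); [|lra].
  apply bounded_terms_abs; trivial; lra.
Qed.

(** * Binomial theorem and recentring of power series *)

Fixpoint binom (n j : nat) : R :=
  match n, j with
  | _, O => 1
  | O, S _ => 0
  | S n', S j' => binom n' j' + binom n' (S j')
  end.

Lemma binom_small n j : (n < j)%nat -> binom n j = 0.
Proof.
  revert j; induction n; intros [|j] H; simpl; try lia; trivial.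
  rewrite !IHn by lia. ring.
Qed.

Lemma binom_ge0 n j : 0 <= binom n j.
Proof.
  revert j; induction n; intros [|j]; simpl; try lra.
  generalize (IHn j) (IHn (S j)); lra.
Qed.

Lemma binom_theorem n (k h : C) :
  csum (S n) (fun j => binom n j * k ^ (n - j) * h ^ j)%C = ((k + h) ^ n)%C.
Proof.
  induction n; [simpl; ring|].
  rewrite csum_shift.
  rewrite (csum_ext (S n) _ (fun i => h * (binom n i * k ^ (n - i) * h ^ i) +
     k * (binom n (S i) * k ^ (n - S i) * h ^ S i))%C).
  - rewrite csum_plus, !csum_scal, IHn.
    assert (E : csum (S (S n)) (fun j => binom n j * k ^ (n - j) * h ^ j)%C = ((k + h) ^ n)%C).
    { rewrite (csum_trunc (S n)); [apply IHn|lia|].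
      intros i Hi. rewrite binom_small by lia. ring. }
    rewrite csum_shift in E. set (X := csum (S n) _) in E |- *.
    replace X with ((k + h) ^ n - k ^ n)%C.
    + cbn [binom Nat.sub Cpow]. ring.
    + rewrite <- E. replace (binom n 0) with 1 by now destruct n.
      rewrite Nat.sub_0_r. cbn [Cpow]. ring.
  - intros i Hi. cbn [binom]. rewrite RtoC_plus. cbn [Nat.sub].
    destruct (Nat.eq_dec i n) as [->|N].
    + rewrite (binom_small n (S n)) by lia. cbn [Cpow]. ring.
    + replace (n - i)%nat with (S (n - S i)) by lia. cbn [Cpow]. ring.
Qed.

Lemma binom_theorem_R n k h : rsum (S n) (fun j => binom n j * k ^ (n - j) * h ^ j) = (k + h) ^ n.
Proof.
  apply RtoC_inj. rewrite RtoC_pow, RtoC_plus, <- binom_theorem, <- csum_RtoC.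
  apply csum_ext; intros. now rewrite !RtoC_mult, !RtoC_pow.
Qed.

Lemma binom_sum_le n J k h : 0 <= k -> 0 <= h ->
  rsum J (fun j => binom n j * k ^ (n - j) * h ^ j) <= (k + h) ^ n.
Proof.
  intros Hk Hh. rewrite <- binom_theorem_R.
  assert (P : forall j, 0 <= binom n j * k ^ (n - j) * h ^ j).
  { intros j. repeat apply Rmult_le_pos; try apply pow_le; trivial. apply binom_ge0. }
  destruct (Nat.le_gt_cases J (S n)); [now apply rsum_mono|].
  replace J with (S n + (J - S n))%nat by lia. rewrite rsum_add.
  rewrite (rsum_ext (J - S n) _ (fun _ => 0)); [rewrite rsum_const; lra|].
  intros i _. rewrite binom_small by lia. ring.
Qed.

(* [b] lists the Taylor coefficients at [k] of [sum_n a_n z^n]; for [j > n] the coefficient [binom n j]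
   is [0], which neutralizes the truncated [n - j]. *)
Definition shifted (a : nat -> C) (k : C) (b : nat -> C) : Prop :=
  forall j, csums (fun n => a n * (binom n j * k ^ (n - j)))%C (b j).

(** Expand [(k + h)^n] and exchange the sums, which is legitimate because [sum |a_n| (|k| + |h|)^n]
    is finite for [|k| + |h| < R0]. *)
Lemma ps_shift a R0 k : converges_within a R0 -> Cmod k < R0 ->
  exists b, shifted a k b /\
    forall h l, Cmod h < R0 - Cmod k -> ps a (k + h)%C l -> ps b h l.
Proof.
  intros Ha Hk. assert (Pk := Cmod_ge_0 k).
  assert (Ex : forall j, exists l, csums (fun n => a n * (binom n j * k ^ (n - j)))%C l).
  (* An auxiliary [h > 0] with [|k| + h < R0] gives absolute convergence: [binom i j |k|^(i-j) h^j]
     is one term of [(|k| + h)^i]. *)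
  { intros j. set (h := (R0 - Cmod k) / 2). assert (Hh : 0 < h) by (unfold h; lra).
    destruct (converges_abs a R0 (Cmod k + h) Ha) as [B HB]; [unfold h; lra|].
    apply (abs_csums _ (B * / h ^ j)); intros n.
    assert (Hj : 0 < h ^ j) by now apply pow_lt.
    apply Rmult_le_reg_r with (h ^ j); trivial.
    rewrite Rmult_assoc, Rinv_l, Rmult_1_r, Rmult_comm, <- rsum_scal by lra.
    eapply Rle_trans; [|apply (HB n)]. apply rsum_le; intros i _.
    rewrite !Cmod_mult, Cmod_R, Rabs_pos_eq, Cmod_pow by apply binom_ge0.
    replace (h ^ j * _) with (Cmod (a i) * (binom i j * Cmod k ^ (i - j) * h ^ j)) by ring.
    apply Rmult_le_compat_l; [apply Cmod_ge_0|].
    eapply Rle_trans; [|apply (binom_sum_le i (S j) (Cmod k) h); lra].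
    apply (rsum_term_le (S j) j (fun j => binom i j * Cmod k ^ (i - j) * h ^ j)); [|lia].
    intros; repeat apply Rmult_le_pos; try apply pow_le; try lra. apply binom_ge0. }
  exists (fun j => proj1_sig (constructive_indefinite_description _ (Ex j))).
  assert (Sh : shifted a k (fun j => proj1_sig (constructive_indefinite_description _ (Ex j)))).
  { intros j. apply (proj2_sig (constructive_indefinite_description _ (Ex j))). }
  split; trivial. revert Sh. generalize (fun j => proj1_sig (constructive_indefinite_description _ (Ex j))).
  intros b Sh h l Hh Hl. assert (Ph := Cmod_ge_0 h).
  destruct (converges_abs a R0 (Cmod k + Cmod h) Ha) as [B HB]; [lra|].
  apply (csums_exchange (fun n j => a n * (binom n j * k ^ (n - j)) * h ^ j)%C
    (fun n => a n * (k + h) ^ n)%C _ (fun n => Cmod (a n) * (Cmod k + Cmod h) ^ n) B); trivial.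
  - intros n J. eapply Rle_trans; [apply csum_mod|].
    rewrite (rsum_ext J _ (fun j => Cmod (a n) * (binom n j * Cmod k ^ (n - j) * Cmod h ^ j))).
    + rewrite rsum_scal. apply Rmult_le_compat_l; [apply Cmod_ge_0|]. now apply binom_sum_le.
    + intros j _. rewrite !Cmod_mult, Cmod_R, Rabs_pos_eq, !Cmod_pow by apply binom_ge0. ring.
  - intros n. rewrite <- binom_theorem, <- csum_scal.
    rewrite (csum_ext _ _ (fun j => a n * (binom n j * k ^ (n - j)) * h ^ j)%C) by (intros; ring).
    apply csums_fin. intros j Hj. rewrite binom_small by lia. ring.
  - intros j. generalize (csums_scal (h ^ j) _ _ (Sh j)). rewrite Cmult_comm.
    apply csums_ext; intros; ring.
Qed.

(** * Local expansions and their continuation to the whole disk *)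

Definition ps_on (f : C -> C) (z0 : C) (a : nat -> C) (r : R) : Prop :=
  forall h, Cmod h < r -> ps a h (f (z0 + h)%C).

Lemma ps_on_converges f z0 a r : ps_on f z0 a r -> converges_within a r.
Proof. intros H z Hz. eexists; now apply H. Qed.

Lemma ps_on_recenter f z0 a r k : ps_on f z0 a r -> Cmod k < r ->
  exists b, shifted a k b /\ ps_on f (z0 + k)%C b (r - Cmod k).
Proof.
  intros H Hk. destruct (ps_shift a r k (ps_on_converges _ _ _ _ H) Hk) as [b [S1 S2]].
  exists b; split; trivial. intros h Hh. apply S2; trivial.
  replace (z0 + k + h)%C with (z0 + (k + h))%C by ring. apply H.
  eapply Rle_lt_trans; [apply Cmod_triangle|]. lra.
Qed.

Lemma ps_on_unique f z0 a b r : 0 < r -> ps_on f z0 a r -> ps_on f z0 b r -> forall n, a n = b n.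
Proof.
  intros Hr Ha Hb. apply (ps_unique a b r Hr). intros z Hz. exists (f (z0 + z)%C). split; auto.
Qed.

Lemma ps_ext a b z l : (forall n, a n = b n) -> ps a z l -> ps b z l.
Proof. intros E. apply csums_ext; intros; now rewrite E. Qed.

(** Compactness of a square containing the disk: the expansion about a centre [(u, v)] is recentred
    at nearby points, and the gauges of the selected centres are bounded below by one common
    radius. *)
Lemma uniform_radius f rho : (forall z, Cmod z < 1 -> analytic_at f z) -> 0 < rho < 1 ->
  exists d, 0 < d /\ forall w, Cmod w <= rho -> exists b, ps_on f w b d.
Proof.
  intros Hf Hr.
  (* Inside the disk the gauge is a quarter of the radius of expansion, so a point within [2 del] of
     the centre keeps a radius above [2 del]. Outside, the gauge is half the distance to the disk,
     so such a centre is never selected for a point of the disk. *)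
  assert (Loc : forall u v : R, exists d : posreal,
    (Cmod (u, v) <= rho -> exists b, ps_on f (u, v) b (4 * d)) /\
    (rho < Cmod (u, v) -> 2 * d <= Cmod (u, v) - rho)).
  { intros u v. destruct (Rle_or_lt (Cmod (u, v)) rho) as [L|L].
    - destruct (Hf (u, v)) as [a [r [Pr Ha]]]; [lra|].
      assert (P4 : 0 < r / 4) by lra. exists (mkposreal _ P4). split; [|lra].
      intros _. exists a. intros h Hh. apply ps_is_pseries, Ha. cbn [pos] in Hh. lra.
    - assert (P4 : 0 < (Cmod (u, v) - rho) / 2) by lra. exists (mkposreal _ P4).
      cbn [pos]; split; intros; lra. }
  set (del := fun u v => proj1_sig (constructive_indefinite_description _ (Loc u v))).
  assert (Hdel : forall u v, (Cmod (u, v) <= rho -> exists b, ps_on f (u, v) b (4 * del u v)) /\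
    (rho < Cmod (u, v) -> 2 * del u v <= Cmod (u, v) - rho)).
  { intros u v. apply (proj2_sig (constructive_indefinite_description _ (Loc u v))). }
  destruct (compactness_value_2d (-1) 1 (-1) 1 del) as [d Hd].
  exists d; split; [apply cond_pos|]. intros [x y] Hw.
  assert (B := Rmax_Cmod (x, y)). simpl in B.
  assert (Bx := Rmax_l (Rabs x) (Rabs y)). assert (By := Rmax_r (Rabs x) (Rabs y)).
  assert (Ix : -1 <= x <= 1) by (apply Rabs_le_between; lra).
  assert (Iy : -1 <= y <= 1) by (apply Rabs_le_between; lra).
  destruct (NNPP _ (Hd x y Ix Iy)) as [u [v [_ [_ [Hu [Hv Huv]]]]]].
  destruct (Hdel u v) as [D1 D2].
  set (k := (x - u, y - v) : C).
  assert (Hk : Cmod k < 2 * del u v).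
  { replace k with (RtoC (x - u) + Ci * RtoC (y - v))%C
      by (apply injective_projections; simpl; ring).
    eapply Rle_lt_trans; [apply Cmod_triangle|].
    rewrite Cmod_mult, Cmod_Ci, !Cmod_R. lra. }
  assert (Ek : ((u, v) + k)%C = (x, y)) by (apply injective_projections; simpl; ring).
  destruct (Rle_or_lt (Cmod (u, v)) rho) as [L|L].
  - assert (P := cond_pos (del u v)). destruct (D1 L) as [b Hb].
    destruct (ps_on_recenter _ _ _ _ k Hb) as [b' [_ Hb']]; [lra|].
    rewrite Ek in Hb'. exists b'. intros h Hh. apply Hb'. lra.
  - exfalso. specialize (D2 L).
    assert (Cmod (u, v) <= Cmod (x, y) + Cmod k).
    { rewrite <- (Cmod_opp k). replace (u, v) with ((x, y) + - k)%C at 1.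
      - apply Cmod_triangle.
      - rewrite <- Ek. ring. }
    lra.
Qed.

Lemma csums_unshift j u l : (forall n, (n < j)%nat -> u n = RtoC 0) -> csums u l ->
  csums (fun i => u (j + i)%nat) l.
Proof.
  intros Z H eps He. destruct (H eps He) as [N HN]. exists N; intros n L.
  specialize (HN (j + n)%nat ltac:(lia)). now rewrite csum_add, csum_0, Cplus_0_l in HN.
Qed.

(* Weierstrass' argument. On the circle [|w| = s - d/4] the [j]-th recentred coefficient is a power
   series in [w] bounded by [(3d/4)^-j], so Cauchy's estimate gives
   [binom n j * |a_n| * (s - d/4)^(n-j) <= (3d/4)^-j]; summing against [(d/2)^j] over [j] shows that
   [|a_n| * (s + d/4)^n] is bounded. *)
Lemma extend_radius f a s d rho :
  (forall z, Cmod z < 1 -> Cmod (f z) <= 1) -> 0 < d <= 1 - rho -> d <= s <= rho ->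
  (forall w, Cmod w <= rho -> exists b, ps_on f w b d) ->
  ps_on f 0 a s -> ps_on f 0 a (s + d / 4).
Proof.
  intros Hf Hd Hs Hu Ha. set (sg := s - d / 4). assert (Hsg : 0 < sg) by (unfold sg; lra).
  assert (Cv := ps_on_converges _ _ _ _ Ha).
  assert (C1 : forall w b, Cmod w = sg -> shifted a w b ->
     ps_on f w b d /\ forall j, Cmod (b j) * (3 * d / 4) ^ j <= 1).
  { intros w b Hw Sh.
    destruct (ps_on_recenter f 0 a s w Ha) as [b1 [S1 Hb1]]; [unfold sg in *; lra|].
    rewrite Cplus_0_l in Hb1.
    destruct (Hu w) as [b2 Hb2]; [unfold sg in *; lra|].
    (* The recentred series is known to represent [f] only within [d/4] of [w]; uniqueness
       identifies it with the expansion of radius [d]. *)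
    assert (E : forall j, b2 j = b j).
    { intros j. rewrite (csums_unique _ _ _ (Sh j) (S1 j)). symmetry. revert j.
      apply (ps_on_unique f w b1 b2 (d / 4)); [lra| |].
      - intros h Hh. apply Hb1. unfold sg in *; lra.
      - intros h Hh. apply Hb2. lra. }
    assert (P : ps_on f w b d) by (intros h Hh; apply (ps_ext _ _ _ _ E), Hb2, Hh).
    split; trivial. intros j.
    apply (cauchy_estimate b 1 d (3 * d / 4) j); [lra|now apply (ps_on_converges f w)|].
    intros z l Hz Hl. rewrite (csums_unique _ _ _ Hl (P z ltac:(lra))). apply Hf.
    eapply Rle_lt_trans; [apply Cmod_triangle|]. unfold sg in *; lra. }
  assert (C2 : forall n j, (j <= n)%nat ->
     Cmod (a n) * (binom n j * sg ^ (n - j)) <= / (3 * d / 4) ^ j).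
  (* The [j]-th recentred coefficient as a power series in the centre [w], reindexed by
     [n = j + i]. *)
  { intros n j Hj. set (e := fun i => (a (j + i)%nat * binom (j + i) j)%C).
    assert (Sh : forall w b, shifted a w b -> ps e w (b j)).
    { intros w b Sh. assert (Sj := Sh j). apply (csums_unshift j) in Sj.
      - revert Sj. apply csums_ext; intros i. unfold e. replace (j + i - j)%nat with i by lia. ring.
      - intros i Hi. rewrite binom_small by trivial. ring. }
    assert (Ce : converges_within e s).
    { intros w Hw. destruct (ps_shift a s w Cv Hw) as [b [S1 _]]. exists (b j). now apply Sh. }
    assert (Hsg' : 0 <= sg < s) by (unfold sg in *; lra).
    assert (Q := cauchy_estimate e (/ (3 * d / 4) ^ j) s sg (n - j) Hsg' Ce).
    unfold e in Q at 2. replace (j + (n - j))%nat with n in Q by lia.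
    rewrite Cmod_mult, Cmod_R, Rabs_pos_eq, Rmult_assoc in Q by apply binom_ge0. apply Q.
    intros w l Hw Hl. destruct (ps_shift a s w Cv) as [b [S1 _]]; [lra|].
    rewrite (csums_unique _ _ _ Hl (Sh w b S1)).
    destruct (C1 w b Hw S1) as [_ B]. specialize (B j).
    assert (P : 0 < (3 * d / 4) ^ j) by (apply pow_lt; lra).
    apply Rmult_le_reg_r with ((3 * d / 4) ^ j); trivial. rewrite Rinv_l; lra. }
  set (tau := s + d / 4).
  assert (C3 : forall n, Cmod (a n) * tau ^ n <= 3).
  { intros n. replace tau with (sg + d / 2) by (unfold sg, tau; lra).
    rewrite <- binom_theorem_R, <- rsum_scal.
    apply Rle_trans with (rsum (S n) (pow (2 / 3))).
    - apply rsum_le; intros j Hj. specialize (C2 n j ltac:(lia)).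
      assert (P : 0 < (3 * d / 4) ^ j) by (apply pow_lt; lra).
      replace ((2 / 3) ^ j) with (/ (3 * d / 4) ^ j * (d / 2) ^ j).
      + rewrite <- !Rmult_assoc in *. apply Rmult_le_compat_r; [apply pow_le; lra|trivial].
      + rewrite <- pow_inv, <- Rpow_mult_distr. f_equal. field. lra.
    - eapply Rle_trans; [apply rsum_geom_le; lra|]. lra. }
  assert (Ct := bounded_terms_converge a 3 tau C3).
  intros z Hz. rewrite Cplus_0_l. destruct (Rlt_or_le (Cmod z) s) as [L|L].
  - rewrite <- (Cplus_0_l z) at 2. now apply Ha.
  - destruct (Ct z Hz) as [l Hl].
    (* [w] is the point of modulus [sg] on the ray through [z]. As [|z - w| < d/2], the series
       recentred at [w] sums at [z] both to the value of the original series and to [f z]. *)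
    set (w := (RtoC (sg / Cmod z) * z)%C). set (h := (RtoC (1 - sg / Cmod z) * z)%C).
    assert (Q : 0 < sg / Cmod z < 1).
    { split; [apply Rdiv_lt_0_compat; lra|]. apply Rmult_lt_reg_r with (Cmod z); [lra|].
      unfold Rdiv. rewrite Rmult_assoc, Rinv_l by lra. unfold sg in *; lra. }
    assert (Hw : Cmod w = sg) by (unfold w; rewrite Cmod_mult, Cmod_R, Rabs_pos_eq by lra; field; lra).
    assert (Hh : Cmod h = Cmod z - sg) by (unfold h; rewrite Cmod_mult, Cmod_R, Rabs_pos_eq by lra; field; lra).
    assert (Ez : z = (w + h)%C) by (unfold w, h; rewrite RtoC_minus; ring).
    destruct (ps_shift a tau w Ct) as [b [S1 S2]]; [unfold tau, sg in *; lra|].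
    destruct (C1 w b Hw S1) as [P _].
    assert (Hb : ps b h l) by (apply S2; [unfold tau, sg in *; lra|now rewrite <- Ez]).
    assert (Hb' : ps b h (f (w + h)%C)) by (apply P; unfold tau, sg in *; lra).
    rewrite <- Ez in Hb'. now rewrite <- (csums_unique _ _ _ Hb Hb').
Qed.

(** From the expansion at 0, each continuation step gains [d/4], where [d] is fixed by a target
    radius [rho] strictly between [|z|] and 1; finitely many steps reach [z], and the coefficients
    never change. *)
Lemma disk_expansion f :
  (forall z, Cmod z < 1 -> analytic_at f z) -> (forall z, Cmod z < 1 -> Cmod (f z) <= 1) ->
  exists a, forall z, Cmod z < 1 -> ps a z (f z).
Proof.
  intros Ha Hf. destruct (Ha 0) as [a [r [Hr H0]]]; [rewrite Cmod_0; lra|].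
  assert (A0 : ps_on f 0 a r) by (intros h Hh; apply ps_is_pseries, H0, Hh).
  exists a; intros z Hz. set (rho := (1 + Cmod z) / 2). assert (Pz := Cmod_ge_0 z).
  destruct (uniform_radius f rho Ha) as [d0 [Pd Hu0]]; [unfold rho; lra|].
  set (d := Rmin d0 (Rmin (1 - rho) rho)).
  assert (D1 : d <= d0) by apply Rmin_l.
  assert (D2 : d <= 1 - rho) by (eapply Rle_trans; [apply Rmin_r|apply Rmin_l]).
  assert (D3 : d <= rho) by (eapply Rle_trans; [apply Rmin_r|apply Rmin_r]).
  assert (D0 : 0 < d) by (repeat apply Rmin_pos; unfold rho; lra).
  assert (Hu : forall w, Cmod w <= rho -> exists b, ps_on f w b d).
  { intros w Hw. destruct (Hu0 w Hw) as [b Hb]. exists b; intros h Hh. apply Hb; lra. }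
  destruct (Hu 0) as [b Hb]; [rewrite Cmod_0; unfold rho; lra|].
  assert (E : forall n, b n = a n).
  { apply (ps_on_unique f 0 b a (Rmin d r)); [now apply Rmin_pos| |].
    - intros h Hh. apply Hb. eapply Rlt_le_trans; [exact Hh|apply Rmin_l].
    - intros h Hh. apply A0. eapply Rlt_le_trans; [exact Hh|apply Rmin_r]. }
  assert (St : forall n, ps_on f 0 a (Rmin (d + INR n * (d / 4)) rho)).
  { induction n.
    - intros h Hh. apply (ps_ext _ _ _ _ E), Hb. eapply Rlt_le_trans; [exact Hh|].
      eapply Rle_trans; [apply Rmin_l|]. simpl; lra.
    - assert (Pn := pos_INR n).
      assert (D4 : d <= d + INR n * (d / 4)) by nra.
      assert (G := extend_radius f a _ d rho Hf (conj D0 D2)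
        (conj (Rmin_glb _ _ d D4 D3) (Rmin_r _ _)) Hu IHn).
      intros h Hh. apply G. eapply Rlt_le_trans; [exact Hh|]. rewrite S_INR.
      destruct (Rle_or_lt (d + INR n * (d / 4)) rho).
      + rewrite (Rmin_left (d + INR n * (d / 4))) by trivial.
        eapply Rle_trans; [apply Rmin_l|]. lra.
      + rewrite (Rmin_right (d + INR n * (d / 4))) by lra.
        eapply Rle_trans; [apply Rmin_r|]. lra. }
  destruct (INR_unbounded (4 / d)) as [n Hn].
  rewrite <- (Cplus_0_l z) at 2. apply (St n). apply Rmin_glb_lt; [|unfold rho; lra].
  apply Rmult_lt_compat_r with (r := d / 4) in Hn; [|lra].
  replace (4 / d * (d / 4)) with 1 in Hn by (field; lra). lra.
Qed.

(** * Coefficients of powers and subordination *)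

(* [pw c n m] is the [m]-th coefficient of the [n]-th power of [sum_i c_i z^i]. *)
Fixpoint pw (c : nat -> C) (n : nat) : nat -> C :=
  match n with O => delta 0 | S k => conv c (pw c k) end.

(* Littlewood subordination: with [f = x_0 + z * Bf], one has [f o phi = x_0 + phi * (Bf o phi)], the
   two terms are orthogonal since [phi(0) = 0], and multiplication by [phi] is a contraction. *)
Lemma littlewood c x N K : maps_disk c -> c 0%nat = RtoC 0 ->
  rsum N (fun m => Cmod (csum K (fun n => x n * pw c n m)%C) ^ 2) <=
  rsum K (fun n => Cmod (x n) ^ 2).
Proof.
  intros Hc c0. revert x; induction K; intros x.
  - simpl. rewrite Cmod_0, (rsum_ext _ _ (fun _ => 0)) by (intros; ring). rewrite rsum_const. lra.
  - set (G := fun m => csum K (fun n => x (S n) * pw c n m)%C).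
    assert (E : forall m, csum (S K) (fun n => x n * pw c n m)%C = (x 0%nat * delta 0 m + conv c G m)%C).
    { intros m. rewrite csum_shift. f_equal. unfold conv, G. cbn [pw]. unfold conv.
      rewrite (csum_ext (S m) _ (fun i => csum K (fun n => c i * (x (S n) * pw c n (m - i)%nat)))%C)
        by (intros; now rewrite csum_scal).
      rewrite csum_swap. apply csum_ext; intros n _. rewrite <- csum_scal.
      apply csum_ext; intros; ring. }
    rewrite (rsum_ext N _ (fun m => Cmod (x 0%nat * delta 0 m + conv c G m)%C ^ 2))
      by (intros; now rewrite E).
    assert (T := Rle_trans _ _ _ (maps_disk_toeplitz c G N Hc) (IHK (fun n => x (S n)))).
    change (S K) with (1 + K)%nat. rewrite (rsum_add 1 K). change (rsum 1 _) with (0 + Cmod (x 0%nat) ^ 2).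
    destruct N; [simpl rsum at 1|].
    { assert (0 <= rsum K (fun i => Cmod (x (1 + i)%nat) ^ 2)) by (apply rsum_ge0; intros; apply pow2_ge_0).
      assert (P := pow2_ge_0 (Cmod (x 0%nat))). lra. }
    change (S N) with (1 + N)%nat in *. rewrite (rsum_add 1 N) in *.
    rewrite (rsum_ext N (fun i => Cmod (x 0%nat * delta 0 (1 + i) + conv c G (1 + i))%C ^ 2)
       (fun i => Cmod (conv c G (1 + i)) ^ 2)).
    2:{ intros i _. change (delta 0 (1 + i)) with (RtoC 0). now rewrite Cmult_0_r, Cplus_0_l. }
    assert (C0 : conv c G 0 = RtoC 0) by (unfold conv; simpl; rewrite c0; ring).
    cbn [rsum] in *. rewrite C0, Cmod_0 in T. rewrite C0.
    replace (x 0%nat * delta 0 0 + 0)%C with (x 0%nat) by (unfold delta; simpl; ring).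
    simpl Nat.add in *. lra.
Qed.

Lemma pw_small c n m : c 0%nat = RtoC 0 -> (m < n)%nat -> pw c n m = RtoC 0.
Proof.
  intros c0. revert m; induction n; intros m H; [lia|]. cbn [pw]. apply csum_0; intros i Hi.
  destruct i; [rewrite c0; ring|]. rewrite IHn by lia. ring.
Qed.

Lemma pw_diag c n : c 0%nat = RtoC 0 -> pw c n n = (c 1%nat ^ n)%C.
Proof.
  intros c0. induction n; [unfold pw, delta; now simpl|]. cbn [pw]. unfold conv.
  rewrite (csum_single (S (S n)) 1); [|lia|].
  - replace (S n - 1)%nat with n by lia. now rewrite IHn.
  - intros i Hi N. destruct i; [rewrite c0; ring|]. rewrite pw_small by (trivial; lia). ring.
Qed.

(** Since [phi^n = z^n (c_1 + c_2 z + ...)^n], this is the linear coefficient of the last factor.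
    For [n = 0] the truncated exponent [n - 1] is harmless, as the factor [INR n] is 0. *)
Lemma pw_next c n : c 0%nat = RtoC 0 -> pw c n (S n) = (INR n * (c 1%nat ^ (n - 1) * c 2%nat))%C.
Proof.
  intros c0. induction n; [unfold pw, delta; simpl; ring|]. cbn [pw]. unfold conv.
  rewrite csum_shift, csum_shift, csum_shift, c0, csum_0.
  - replace (S (S n) - 1)%nat with (S n) by lia. replace (S (S n) - 2)%nat with n by lia.
    rewrite IHn, pw_diag, S_INR, RtoC_plus by trivial.
    replace (S n - 1)%nat with n by lia.
    destruct n; [simpl; ring|]. replace (S n - 1)%nat with n by lia. rewrite Cpow_S. ring.
  - intros i Hi. rewrite pw_small by (trivial; lia). ring.
Qed.

(** Subordination applied to the monomial [z^n]: the squared moduli of the coefficients of [phi^n]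
    sum to at most 1. *)
Lemma pw_bound c n m : maps_disk c -> c 0%nat = RtoC 0 -> Cmod (pw c n m) <= 1.
Proof.
  intros Hc c0. assert (L := littlewood c (delta n) (S m) (S n) Hc c0).
  assert (S1 : forall f, csum (S n) (fun i => delta n i * f i)%C = f n).
  { intros f. rewrite (csum_single (S n) n); [|lia|].
    - unfold delta. destruct (Nat.eq_dec n n); [ring|lia].
    - intros i _ N. unfold delta. destruct (Nat.eq_dec i n); [lia|ring]. }
  rewrite (rsum_ext (S m) _ (fun j => Cmod (pw c n j) ^ 2)) in L
    by (intros; now rewrite (S1 (fun n => pw c n i))).
  assert (E : rsum (S n) (fun i => Cmod (delta n i) ^ 2) = 1).
  { simpl. rewrite (rsum_ext n _ (fun _ => 0)), rsum_const.
    - unfold delta. destruct (Nat.eq_dec n n); [|lia]. rewrite Cmod_1; ring.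
    - intros i Hi. unfold delta. destruct (Nat.eq_dec i n); [lia|]. rewrite Cmod_0; ring. }
  rewrite E in L.
  assert (P := rsum_term_le (S m) m (fun j => Cmod (pw c n j) ^ 2) (fun _ => pow2_ge_0 _) ltac:(lia)).
  cbv beta in P. assert (Q := Cmod_ge_0 (pw c n m)). nra.
Qed.

(** Induction by Cauchy products; the powers converge absolutely because their coefficients are at
    most 1 in modulus. *)
Lemma pw_ps c n z l : maps_disk c -> c 0%nat = RtoC 0 -> Cmod z < 1 -> ps c z l ->
  ps (pw c n) z (l ^ n)%C.
Proof.
  intros Hc c0 Hz Hl. assert (Pz := Cmod_ge_0 z).
  destruct (converges_abs c 1 (Cmod z)) as [B HB]; [|lra|].
  { intros w Hw. destruct (Hc w Hw) as [k Hk]. exists k; tauto. }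
  induction n.
  - assert (F := csums_fin 1 (fun m => delta 0 m * z ^ m)%C).
    simpl in F. replace (0 + delta 0 0 * 1)%C with (RtoC 1) in F by (unfold delta; simpl; ring).
    apply F. intros [|n] Hn; [lia|]. unfold delta; simpl; ring.
  - rewrite Cpow_S. cbn [pw].
    apply (csums_ext (conv (fun n => c n * z ^ n)%C (fun m => pw c n m * z ^ m)%C)).
    { intros m. apply conv_pow. }
    apply (csums_conv _ _ _ _ B (1 * / (1 - Cmod z / 1))); trivial.
    + intros k. now rewrite rsum_ps_abs.
    + intros k. rewrite rsum_ps_abs. apply bounded_terms_abs; [|lra].
      intros m. rewrite pow1, Rmult_1_r. now apply pw_bound.
Qed.

(** Coefficients of [f o phi]. The sum stops at [n = m] because [phi^n] vanishes at 0 to order at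
    least [n] when [phi(0) = 0]. *)
Definition compose (c x : nat -> C) (m : nat) : C := csum (S m) (fun n => x n * pw c n m)%C.

(** Exchange of summation: row [n] expands [x_n phi(z)^n], starts at [m = n] and involves
    coefficients of modulus at most 1, so it is dominated by [|x_n| |z|^n / (1 - |z|)]. *)
Lemma ps_compose c x z l s : maps_disk c -> c 0%nat = RtoC 0 -> converges_within x 1 ->
  Cmod z < 1 -> ps c z l -> ps x l s -> ps (compose c x) z s.
Proof.
  intros Hc c0 Hx Hz Hl Hs. assert (Pz := Cmod_ge_0 z).
  destruct (converges_abs x 1 (Cmod z) Hx) as [B HB]; [lra|].
  assert (P1 : 0 < / (1 - Cmod z)) by (apply Rinv_0_lt_compat; lra).
  apply (csums_exchange (fun n m => x n * (pw c n m * z ^ m))%C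
    (fun n => x n * l ^ n)%C _ (fun n => (Cmod (x n) * Cmod z ^ n) * / (1 - Cmod z)) (B * / (1 - Cmod z))); trivial.
  - intros n j. eapply Rle_trans; [apply csum_mod|].
    apply Rle_trans with (rsum j (fun m => (Cmod (x n)) * Cmod (if (n <=? m)%nat then (fun i => z ^ n * z ^ i)%C (m - n)%nat else RtoC 0))).
    + apply rsum_le; intros m _. rewrite Cmod_mult. apply Rmult_le_compat_l; [apply Cmod_ge_0|].
      destruct (Nat.leb_spec n m).
      * cbv beta. rewrite <- Cpow_add_r. replace (n + (m - n))%nat with m by lia.
        rewrite Cmod_mult. rewrite <- (Rmult_1_l (Cmod (z ^ m))) at 2.
        apply Rmult_le_compat_r; [apply Cmod_ge_0|now apply pw_bound].
      * rewrite pw_small by trivial. rewrite Cmult_0_l. lra.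
    + rewrite rsum_scal, Rmult_assoc. apply Rmult_le_compat_l; [apply Cmod_ge_0|].
      eapply Rle_trans; [apply (rsum_shift_abs n j (fun i => z ^ n * z ^ i)%C)|].
      rewrite (rsum_ext j _ (fun i => Cmod z ^ n * Cmod z ^ i)) by (intros; now rewrite Cmod_mult, !Cmod_pow).
      rewrite rsum_scal. apply Rmult_le_compat_l; [now apply pow_le|]. apply rsum_geom_le; lra.
  - intros n. rewrite (rsum_ext n _ (fun i => / (1 - Cmod z) * (Cmod (x i) * Cmod z ^ i))) by (intros; ring).
    rewrite rsum_scal, Rmult_comm. apply Rmult_le_compat_r; [lra|apply HB].
  - intros n. apply (csums_scal (x n) (fun m => pw c n m * z ^ m)%C). now apply pw_ps.
  - intros m. unfold compose. rewrite <- csum_scal_r.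
    rewrite (csum_ext _ _ (fun n => x n * (pw c n m * z ^ m))%C) by (intros; ring).
    apply csums_fin. intros n Hn. rewrite pw_small by (trivial; lia). ring.
Qed.

(** * The weight *)

(* Block [k] ends at [block_end k - 1 = dip k + 1], and [level (k+1) = 1 / dip k]. The weight is
   [level k] on block [k], except at [dip k] where it already is [level (k+1)]; it thus jumps up
   between [dip k] and [dip k + 1], by the factor [k + 3]. *)
Definition dip (k : nat) : nat := fact (k + 3).
Definition level (k : nat) : R := / INR (fact (k + 2)).
Definition block_end (k : nat) : nat := S (S (dip k)).

(** Number of the block containing [n]; [block_end k] is the first index of block [k + 1], where the
    counter advances. *)
Fixpoint block (n : nat) : nat :=
  match n with
  | O => O
  | S m => if Nat.eq_dec (S m) (block_end (block m)) then S (block m) else block m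
  end.

Definition weight (n : nat) : R :=
  if Nat.eq_dec n (dip (block n)) then level (S (block n)) else level (block n).

Lemma dip_pos k : (1 <= dip k)%nat.
Proof. apply lt_O_fact. Qed.

Lemma block_end_le_dip k : (block_end k <= dip (S k))%nat.
Proof.
  unfold block_end, dip. change (S k + 3)%nat with (S (k + 3)). cbn [fact].
  generalize (lt_O_fact (k + 3)). nia.
Qed.

Lemma block_end_lt k : (block_end k < block_end (S k))%nat.
Proof. generalize (block_end_le_dip k). unfold block_end. lia. Qed.

Lemma block_end_mono j k : (j <= k)%nat -> (block_end j <= block_end k)%nat.
Proof.
  intros H. induction H; trivial. generalize (block_end_lt m). lia.
Qed.

Lemma block_spec n :
  (n < block_end (block n))%nat /\ (forall j, block n = S j -> (block_end j <= n)%nat).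
Proof.
  induction n.
  - split; [simpl; unfold block_end; lia|]. simpl; intros; lia.
  - cbn [block]. destruct (Nat.eq_dec (S n) (block_end (block n))) as [E|E].
    + split.
      * rewrite E at 1. apply block_end_lt.
      * intros j Hj. injection Hj as <-. lia.
    + destruct IHn as [I1 I2]. split; [lia|]. intros j Hj. specialize (I2 j Hj). lia.
Qed.

Lemma block_unique n k : (n < block_end k)%nat -> (forall j, k = S j -> (block_end j <= n)%nat) ->
  block n = k.
Proof.
  intros H1 H2. destruct (block_spec n) as [I1 I2].
  destruct (Nat.lt_trichotomy (block n) k) as [L|[E|L]]; trivial; exfalso.
  - destruct k; [lia|]. specialize (H2 k eq_refl).
    generalize (block_end_mono (block n) k). lia.
  - destruct (block n) as [|j]; [lia|]. specialize (I2 j eq_refl).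
    generalize (block_end_mono k j). lia.
Qed.

Lemma block_dip k : block (dip k) = k.
Proof.
  apply block_unique; [unfold block_end; lia|]. intros j ->. apply block_end_le_dip.
Qed.

Lemma block_after_dip k : block (S (dip k)) = k.
Proof.
  apply block_unique; [unfold block_end; lia|]. intros j ->. generalize (block_end_le_dip j). lia.
Qed.

Lemma level_pos k : 0 < level k.
Proof. apply Rinv_0_lt_compat, lt_0_INR, lt_O_fact. Qed.

Lemma level_succ k : level k = (INR k + 3) * level (S k).
Proof.
  unfold level. change (S k + 2)%nat with (S (k + 2)). rewrite fact_simpl, mult_INR, S_INR, plus_INR.
  simpl (INR 2). field. split; [apply INR_fact_neq_0|]. generalize (pos_INR k); lra.
Qed.

Lemma level_dip k : level (S k) = / INR (dip k).
Proof. unfold level, dip. do 3 f_equal. lia. Qed.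

Lemma level_decr k : level (S k) <= level k / 2.
Proof.
  rewrite (level_succ k). generalize (level_pos (S k)) (pos_INR k). intros. nra.
Qed.

Lemma level_le_1 k : level k <= 1.
Proof.
  induction k; [unfold level; simpl; lra|].
  generalize (level_decr k) (level_pos k); lra.
Qed.

Lemma weight_dip k : weight (dip k) = level (S k).
Proof. unfold weight. rewrite block_dip. now destruct (Nat.eq_dec (dip k) (dip k)). Qed.

Lemma weight_after_dip k : weight (S (dip k)) = level k.
Proof.
  unfold weight. rewrite block_after_dip. destruct (Nat.eq_dec (S (dip k)) (dip k)); [lia|easy].
Qed.

Lemma weight_pos n : 0 < weight n.
Proof. unfold weight. destruct (Nat.eq_dec _ _); apply level_pos. Qed.

Lemma weight_le_level n : weight n <= level (block n).
Proof.
  unfold weight. destruct (Nat.eq_dec _ _); [|lra].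
  generalize (level_decr (block n)) (level_pos (block n)); lra.
Qed.

(** Block [j + 1] lies beyond [dip j] and has level [1 / dip j]; at a dip [n] the weight is exactly
    [1 / n]. The factor 1/2 accounts for block 0, whose level is 1/2. *)
Lemma weight_ge_inv n : (1 <= n)%nat -> / 2 * / INR n <= weight n.
Proof.
  intros Hn. assert (P : 1 <= INR n) by (apply (le_INR 1); trivial).
  assert (Pi : 0 < / INR n) by (apply Rinv_0_lt_compat; lra).
  assert (Pj : / INR n <= 1) by (rewrite <- Rinv_1; apply Rinv_le_contravar; lra).
  unfold weight. destruct (Nat.eq_dec _ _) as [E|E].
  - rewrite level_dip, <- E. lra.
  - destruct (block_spec n) as [_ I]. destruct (block n) as [|j].
    + unfold level. simpl. lra.
    + specialize (I j eq_refl). unfold block_end in I.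
      rewrite level_dip. assert (/ INR n <= / INR (dip j)); [|lra].
      apply Rinv_le_contravar; [apply lt_0_INR, dip_pos|]. apply le_INR; lia.
Qed.

Lemma block_rsum_weight s w k X : (s + w = block_end k)%nat -> (s <= dip k)%nat ->
  (forall i, (i < w)%nat -> block (s + i) = k) ->
  rsum w (fun i => weight (s + i) * X (s + i)%nat) =
  level k * (rsum w (fun i => X (s + i)%nat) - X (dip k)) + level (S k) * X (dip k).
Proof.
  intros Hw Hs Hb. unfold block_end in Hw.
  assert (E := rsum_change w (dip k - s) (fun i => weight (s + i) * X (s + i)%nat)
    (fun i => level k * X (s + i)%nat)). cbv beta in E.
  rewrite rsum_scal in E. replace (s + (dip k - s))%nat with (dip k) in E by lia.
  rewrite weight_dip in E. enough (rsum w (fun i => weight (s + i) * X (s + i)%nat) -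
    level (S k) * X (dip k) = level k * rsum w (fun i => X (s + i)%nat) - level k * X (dip k)) by lra.
  apply E; [lia|]. intros i Hi N. unfold weight. rewrite Hb by trivial.
  destruct (Nat.eq_dec (s + i) (dip k)); [lia|easy].
Qed.

Lemma block_rsum_weight_le s w k Y : (forall n, 0 <= Y n) ->
  (forall i, (i < w)%nat -> block (s + i) = k) ->
  rsum w (fun i => weight (s + i) * Y (s + i)%nat) <= level k * rsum w (fun i => Y (s + i)%nat).
Proof.
  intros P Hb. rewrite <- rsum_scal. apply rsum_le; intros i Hi.
  apply Rmult_le_compat_r; trivial. rewrite <- (Hb i Hi). apply weight_le_level.
Qed.

(* With [V k] the mass of [X] up to block [k] without [dip k], halving of the levels gives
   [level (k+1) * V (k+1) <= level k * V k / 2 + (new weighted mass)], so [sum_k level k * V k] telescopes. *)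
Lemma weighted_sum_bound X Y C0 : (forall n, 0 <= X n) -> (forall n, 0 <= Y n) -> 0 <= C0 ->
  (forall k, level k * rsum (block_end k) Y <=
     2 * (level k * (rsum (block_end k) X - X (dip k))) + C0 * (level (S k) * X (dip k))) ->
  forall k, rsum (block_end k) (fun n => weight n * Y n) <=
    (4 + C0) * rsum (block_end k) (fun n => weight n * X n).
Proof.
  intros PX PY P0 H.
  set (V := fun k => rsum (block_end k) X - X (dip k)).
  set (D := fun k => level (S k) * X (dip k)).
  set (MX := fun k => rsum (block_end k) (fun n => weight n * X n)).
  set (MY := fun k => rsum (block_end k) (fun n => weight n * Y n)).
  assert (PV : forall k, 0 <= V k).
  { intros k. assert (X (dip k) <= rsum (block_end k) X); [|unfold V; lra].
    apply rsum_term_le; trivial. unfold block_end; lia. }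
  assert (PD : forall k, 0 <= D k).
  { intros k. apply Rmult_le_pos; trivial. left; apply level_pos. }
  assert (DM : forall k, D k <= MX k).
  { intros k. unfold D. rewrite <- weight_dip.
    apply (rsum_term_le (block_end k) (dip k) (fun n => weight n * X n)).
    - intros; apply Rmult_le_pos; trivial. left; apply weight_pos.
    - unfold block_end; lia. }
  (* The term [2 level k V k] acts as a potential. Block [k + 1] costs at most
     [2 level (k+1) V (k+1)] apart from the dip, and as much again for the new potential; halving
     turns these 4 units into the old potential plus 4 times the new mass. [D k] is withheld on the
     right because the entry at [dip k] joins [V] only in the next block. *)
  assert (Key : forall k, MY k + 2 * (level k * V k) <= 4 * (MX k - D k) + C0 * MX k).
  { induction k.
    - assert (B : forall i, (i < block_end 0)%nat -> block (0 + i) = 0%nat)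
        by (intros; apply block_unique; [trivial|intros; lia]).
      assert (E := block_rsum_weight 0 (block_end 0) 0 X eq_refl (Nat.le_0_l _) B).
      assert (L := block_rsum_weight_le 0 (block_end 0) 0 Y PY B).
      simpl Nat.add in E, L. specialize (H 0%nat).
      change (MX 0%nat = level 0 * V 0%nat + D 0%nat) in E.
      change (MY 0%nat <= level 0 * rsum (block_end 0) Y) in L.
      change (level 0 * rsum (block_end 0) Y <= 2 * (level 0 * V 0%nat) + C0 * D 0%nat) in H.
      assert (C0 * D 0%nat <= C0 * MX 0%nat) by (apply Rmult_le_compat_l; auto). lra.
    - set (w := (block_end (S k) - block_end k)%nat).
      assert (Hw : (block_end k + w = block_end (S k))%nat)
        by (generalize (block_end_mono k (S k)); unfold w; lia).
      assert (B : forall i, (i < w)%nat -> block (block_end k + i) = S k).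
      { intros i Hi. apply block_unique; [lia|]. intros j Hj. injection Hj as <-. lia. }
      assert (E := block_rsum_weight _ w (S k) X Hw (block_end_le_dip k) B).
      assert (L := block_rsum_weight_le _ w (S k) Y PY B).
      set (DX := rsum w (fun i => weight (block_end k + i) * X (block_end k + i)%nat)) in E.
      set (DY := rsum w (fun i => weight (block_end k + i) * Y (block_end k + i)%nat)) in L.
      assert (EX : MX (S k) = MX k + DX) by (unfold MX; now rewrite <- Hw, rsum_add).
      assert (EY : MY (S k) = MY k + DY) by (unfold MY; now rewrite <- Hw, rsum_add).
      assert (EV : V (S k) = V k + X (dip k) + (rsum w (fun i => X (block_end k + i)%nat) - X (dip (S k))))
        by (unfold V; rewrite <- Hw, rsum_add; ring).
      assert (LY : level (S k) * rsum w (fun i => Y (block_end k + i)%nat) <=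
                   level (S k) * rsum (block_end (S k)) Y).
      { apply Rmult_le_compat_l; [left; apply level_pos|]. rewrite <- Hw, rsum_add.
        assert (0 <= rsum (block_end k) Y) by (apply rsum_ge0; auto). lra. }
      assert (HV : level (S k) * V (S k) <= level k * V k / 2 + D k + (DX - D (S k))).
      { rewrite EV, E. unfold D.
        assert (level (S k) * V k <= level k / 2 * V k) by (apply Rmult_le_compat_r; [auto|apply level_decr]).
        lra. }
      specialize (H (S k)). fold (V (S k)) in H. fold (D (S k)) in H.
      assert (DD : C0 * D (S k) <= C0 * DX).
      { apply Rmult_le_compat_l; trivial. unfold D. rewrite E.
        assert (0 <= level (S k) * (rsum w (fun i => X (block_end k + i)%nat) - X (dip (S k)))); [|lra].
        apply Rmult_le_pos; [left; apply level_pos|].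
        assert (X (dip (S k)) <= rsum w (fun i => X (block_end k + i)%nat)); [|lra].
        assert (Hd := block_end_le_dip k).
        replace (dip (S k)) with (block_end k + (dip (S k) - block_end k))%nat at 1 by lia.
        apply (rsum_term_le w (dip (S k) - block_end k) (fun i => X (block_end k + i)%nat)); auto.
        unfold block_end in Hw |- *. unfold block_end in Hd. lia. }
      rewrite EX, EY. lra. }
  intros k. specialize (Key k). specialize (PD k).
  assert (0 <= level k * V k) by (apply Rmult_le_pos; [left; apply level_pos|auto]).
  unfold MX, MY in *. lra.
Qed.

(** * Weighted bound for composition on coefficients *)

Lemma le_block_end n : (n <= block_end n)%nat.
Proof.
  induction n; [lia|]. generalize (block_end_lt n). lia.
Qed.

(** For [i <= m] one has [q^m <= q^i], so [m + 1] copies of [q^m] are dominated by a geometric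
    sum. *)
Lemma linear_geom q : 0 <= q < 1 -> exists K, 0 <= K /\ forall m, (INR m + 1) * q ^ m <= K.
Proof.
  intros Hq. exists (/ (1 - q)). split; [left; apply Rinv_0_lt_compat; lra|]. intros m.
  eapply Rle_trans; [|apply (rsum_geom_le q (S m) Hq)].
  rewrite <- S_INR, <- rsum_const. apply rsum_le; intros i Hi.
  replace m with (i + (m - i))%nat by lia. rewrite pow_add.
  rewrite <- (Rmult_1_r (q ^ i)) at 2. apply Rmult_le_compat_l; [apply pow_le; lra|].
  rewrite <- (pow1 (m - i)). apply pow_incr; lra.
Qed.

(** Reduction to the linear case with a ratio [s < 1] such that [q <= s^3], which Bernoulli's
    inequality provides for [s = 1 - (1 - q)/3]. *)
Lemma cubic_geom q : 0 <= q < 1 -> exists K, 0 <= K /\ forall m, (INR m + 1) ^ 3 * q ^ m <= K.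
Proof.
  intros Hq. set (s := 1 - (1 - q) / 3).
  destruct (linear_geom s) as [K [PK HK]]; [unfold s; lra|].
  exists (K ^ 3); split; [now apply pow_le|]. intros m. assert (P := pos_INR m).
  apply Rle_trans with (((INR m + 1) * s ^ m) ^ 3).
  - rewrite Rpow_mult_distr. apply Rmult_le_compat_l; [apply pow_le; lra|].
    rewrite <- pow_mult, Nat.mul_comm, pow_mult. apply pow_incr. split; [lra|].
    assert (B := bernoulli ((1 - q) / 3) 3 ltac:(lra)). fold s in B. simpl INR in B. lra.
  - apply pow_incr. split; [|apply HK].
    apply Rmult_le_pos; [lra|apply pow_le; unfold s; lra].
Qed.

(** With [q = |c_1|] and [|c_2| <= 1], the bracket bounds the mass that [phi^d] has in its own
    block; the factor [d = 1 / level (k+1)] pays for the small weight at [d = dip k]. The whole is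
    at most [4 (m+1)^3 q^(2m)] with [m = d - 1]. *)
Lemma diagonal_decay q : 0 <= q < 1 -> exists C0, 0 <= C0 /\
  forall d, (1 <= d)%nat -> 2 * ((q ^ d) ^ 2 + (INR d * q ^ (d - 1)) ^ 2) * INR d <= C0.
Proof.
  intros Hq. destruct (cubic_geom (q ^ 2)) as [K [PK HK]]; [nra|].
  exists (4 * K); split; [lra|]. intros [|m] H; [lia|].
  replace (S m - 1)%nat with m by lia. specialize (HK m). assert (P := pos_INR m).
  rewrite S_INR. rewrite <- pow_mult, Nat.mul_comm, pow_mult in HK.
  assert (Q : 0 <= (q ^ m) ^ 2) by apply pow2_ge_0.
  assert (Q1 : (q ^ S m) ^ 2 <= (q ^ m) ^ 2).
  { replace ((q ^ S m) ^ 2) with (q ^ 2 * (q ^ m) ^ 2) by (simpl; ring).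
    assert (q ^ 2 <= 1) by nra. nra. }
  rewrite Rpow_mult_distr. set (Z := (q ^ m) ^ 2) in *. set (n := INR m + 1) in *.
  assert (1 <= n) by (unfold n; lra).
  assert (Z * n <= n ^ 2 * Z * n).
  { replace (n ^ 2 * Z * n) with (n ^ 2 * (Z * n)) by ring.
    assert (0 <= Z * n) by (apply Rmult_le_pos; lra). assert (1 <= n ^ 2) by nra. nra. }
  assert ((q ^ S m) ^ 2 * n <= Z * n) by (apply Rmult_le_compat_r; lra).
  replace (n ^ 3 * Z) with (n ^ 2 * Z * n) in HK by ring. lra.
Qed.

Lemma Cmod_plus_sqr u v : Cmod (u + v) ^ 2 <= 2 * Cmod u ^ 2 + 2 * Cmod v ^ 2.
Proof.
  assert (T := Cmod_triangle u v). assert (P := Cmod_ge_0 (u + v)).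
  assert (Q := pow2_ge_0 (Cmod u - Cmod v)).
  assert (Cmod (u + v) ^ 2 <= (Cmod u + Cmod v) ^ 2) by (apply pow_incr; lra). lra.
Qed.

Lemma maps_disk_sum c N : maps_disk c -> rsum N (fun m => Cmod (c m) ^ 2) <= 1.
Proof.
  intros Hc. assert (T := maps_disk_toeplitz c (delta 0) N Hc).
  rewrite (rsum_ext N _ (fun m => Cmod (c m) ^ 2)) in T by (intros; now rewrite conv_delta0).
  eapply Rle_trans; [exact T|]. destruct N; [simpl; lra|].
  change (S N) with (1 + N)%nat. rewrite rsum_add.
  rewrite (rsum_ext N _ (fun _ => 0)), rsum_const.
  - change (rsum 1 _) with (0 + Cmod 1 ^ 2). rewrite Cmod_1. lra.
  - intros i _. change (delta 0 (1 + i)) with (RtoC 0). rewrite Cmod_0. ring.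
Qed.

(* Only the power [phi^(dip k)] is split off; inside block [k] it has at most two nonzero coefficients. *)
Lemma compose_block c x k : maps_disk c -> c 0%nat = RtoC 0 ->
  rsum (block_end k) (fun m => Cmod (compose c x m) ^ 2) <=
  2 * (rsum (block_end k) (fun n => Cmod (x n) ^ 2) - Cmod (x (dip k)) ^ 2) +
  2 * (Cmod (x (dip k)) ^ 2 * (Cmod (pw c (dip k) (dip k)) ^ 2 + Cmod (pw c (dip k) (S (dip k))) ^ 2)).
Proof.
  intros Hc c0. set (d := dip k). set (e := block_end k).
  assert (He : e = S (S d)) by reflexivity.
  set (x' := fun n => if Nat.eq_dec n d then RtoC 0 else x n).
  assert (E : forall m, (m < e)%nat ->
     compose c x m = (csum e (fun n => x' n * pw c n m) + x d * pw c d m)%C).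
  { intros m Hm. unfold compose. rewrite <- (csum_trunc (S m) e); [|lia|].
    2:{ intros i Hi. rewrite pw_small by (trivial; lia). ring. }
    replace (x d * pw c d m)%C
      with (csum e (fun n => if Nat.eq_dec n d then x n * pw c n m else RtoC 0)%C).
    - rewrite <- csum_plus. apply csum_ext; intros i _. unfold x'. destruct (Nat.eq_dec i d); ring.
    - rewrite (csum_single e d); [now destruct (Nat.eq_dec d d)|lia|].
      intros i _ N. now destruct (Nat.eq_dec i d). }
  apply Rle_trans with (rsum e (fun m => 2 * Cmod (csum e (fun n => x' n * pw c n m)%C) ^ 2 +
      2 * (Cmod (x d) ^ 2 * Cmod (pw c d m) ^ 2))).
  { apply rsum_le; intros m Hm. rewrite E by trivial. eapply Rle_trans; [apply Cmod_plus_sqr|].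
    rewrite (Cmod_mult (x d)), Rpow_mult_distr. lra. }
  rewrite rsum_plus, !rsum_scal. apply Rplus_le_compat; apply Rmult_le_compat_l; try lra.
  - eapply Rle_trans; [apply (littlewood c x' e e Hc c0)|].
    assert (L := rsum_change e d (fun n => Cmod (x n) ^ 2) (fun n => Cmod (x' n) ^ 2)).
    cbv beta in L. rewrite L; [| |].
    + unfold x' at 3. destruct (Nat.eq_dec d d); [|lia]. rewrite Cmod_0. lra.
    + lia.
    + intros i _ N. unfold x'. now destruct (Nat.eq_dec i d).
  - rewrite He. cbn [rsum]. rewrite (rsum_ext d _ (fun _ => 0)), rsum_const; [right; ring|].
    intros i Hi. rewrite pw_small by trivial. rewrite Cmod_0. ring.
Qed.

(** Here [phi(z) = c_1 z], whose powers are monomials. *)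
Lemma pw_rotation c n m : (forall i, i <> 1%nat -> c i = RtoC 0) -> m <> n -> pw c n m = RtoC 0.
Proof.
  intros Hc. revert m; induction n; intros m H.
  - unfold pw, delta. destruct (Nat.eq_dec m 0); [lia|easy].
  - cbn [pw]. apply csum_0; intros i Hi. destruct (Nat.eq_dec i 1) as [->|N].
    + rewrite IHn by lia. ring.
    + rewrite Hc by trivial. ring.
Qed.

(** [K] depends on [c] but not on [x]. A rotation preserves the moduli of all coefficients;
    otherwise the block estimate and the decay of [|c_1|^d] supply the hypothesis of
    [weighted_sum_bound], and [K = 4 + C0]. *)
Lemma weighted_compose_bound c : maps_disk c -> c 0%nat = RtoC 0 ->
  exists K, 0 <= K /\ forall x B,
    (forall n, rsum n (fun i => Cmod (x i) ^ 2 * weight i) <= B) ->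
    forall n, rsum n (fun i => Cmod (compose c x i) ^ 2 * weight i) <= K * B.
Proof.
  intros Hc c0. assert (Q0 := Cmod_ge_0 (c 1%nat)).
  assert (Q1 : Cmod (c 1%nat) <= 1).
  { assert (T := maps_disk_sum c 2 Hc). simpl rsum in T. assert (P := pow2_ge_0 (Cmod (c 0%nat))).
    nra. }
  destruct (Req_dec (Cmod (c 1%nat)) 1) as [E1|N1].
  - (* [phi] is a rotation. *)
    assert (Z : forall i, i <> 1%nat -> c i = RtoC 0).
    (* The squares [|c_i|^2] sum to at most 1, and [c_1] alone exhausts this. *)
    { intros [|[|i]] Hi; [trivial|lia|]. assert (T := maps_disk_sum c (S (S (S i))) Hc).
      cbn [rsum] in T. assert (P := rsum_term_le (S (S i)) 1 (fun m => Cmod (c m) ^ 2)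
        (fun _ => pow2_ge_0 _) ltac:(lia)).
      cbn [rsum] in P. rewrite E1 in P.
      apply Cmod_eq_0. assert (0 <= Cmod (c (S (S i)))) by apply Cmod_ge_0. nra. }
    exists 1; split; [lra|]. intros x B HB n. rewrite Rmult_1_l.
    eapply Rle_trans; [|apply (HB n)]. right. apply rsum_ext; intros m _. f_equal.
    unfold compose. rewrite (csum_single (S m) m); [|lia|].
    + rewrite pw_diag, Cmod_mult, Cmod_pow, E1, pow1 by trivial. ring.
    + intros i _ N. rewrite pw_rotation by auto. ring.
  - destruct (diagonal_decay (Cmod (c 1%nat))) as [C0 [P0 H0]]; [lra|].
    exists (4 + C0); split; [lra|]. intros x B HB n.
    set (X := fun i => Cmod (x i) ^ 2). set (Y := fun i => Cmod (compose c x i) ^ 2).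
    assert (PX : forall i, 0 <= X i) by (intros; apply pow2_ge_0).
    assert (PY : forall i, 0 <= Y i) by (intros; apply pow2_ge_0).
    assert (W := weighted_sum_bound X Y C0 PX PY P0).
    apply Rle_trans with (rsum (block_end n) (fun m => weight m * Y m)).
    + rewrite (rsum_ext n _ (fun m => weight m * Y m)) by (intros; unfold Y; ring).
      apply rsum_mono; [|apply le_block_end].
      intros; apply Rmult_le_pos; trivial. left; apply weight_pos.
    + eapply Rle_trans; [apply W|].
      2:{ apply Rmult_le_compat_l; [lra|]. eapply Rle_trans; [|apply (HB (block_end n))].
          right; apply rsum_ext; intros; unfold X; ring. }
      intros k. assert (Pk := level_pos k).
      eapply Rle_trans; [apply Rmult_le_compat_l; [lra|apply (compose_block c x k Hc c0)]|].
      fold X. fold (X (dip k)).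
      set (ep := Cmod (pw c (dip k) (dip k)) ^ 2 + Cmod (pw c (dip k) (S (dip k))) ^ 2).
      (* The mass of [phi^d] is charged to the weight [level (k+1) = 1/d] of the index [d] itself,
         using [level k <= 1] on the left. *)
      assert (Hep : level k * (2 * ep) <= C0 * level (S k)).
      { specialize (H0 (dip k) (dip_pos k)). rewrite level_dip.
        assert (Pd : 0 < INR (dip k)) by (apply lt_0_INR, dip_pos).
        assert (Pe : 0 <= ep) by (apply Rplus_le_le_0_compat; apply pow2_ge_0).
        assert (Le : ep <= (Cmod (c 1%nat) ^ dip k) ^ 2 + (INR (dip k) * Cmod (c 1%nat) ^ (dip k - 1)) ^ 2).
        { unfold ep. rewrite pw_diag, pw_next, !Cmod_mult, !Cmod_pow, Cmod_R, Rabs_pos_eq by (trivial; lra).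
          apply Rplus_le_compat_l. apply pow_incr. split.
          - repeat apply Rmult_le_pos; try apply pow_le; try apply Cmod_ge_0; lra.
          - apply Rmult_le_compat_l; [lra|].
            rewrite <- (Rmult_1_r (Cmod (c 1%nat) ^ _)) at 2. apply Rmult_le_compat_l; [now apply pow_le|].
            assert (T := maps_disk_sum c 3 Hc). cbn [rsum] in T.
            assert (Z0 := pow2_ge_0 (Cmod (c 0%nat))). assert (Z1 := pow2_ge_0 (Cmod (c 1%nat))).
            assert (Z2 := Cmod_ge_0 (c 2%nat)). nra. }
        apply Rle_trans with (1 * (2 * ep)).
        - apply Rmult_le_compat_r; [lra|apply level_le_1].
        - apply Rmult_le_reg_r with (INR (dip k)); trivial.
          rewrite Rmult_assoc, (Rmult_assoc C0), Rinv_l, Rmult_1_r by lra.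
          eapply Rle_trans; [|exact H0]. rewrite Rmult_1_l.
          apply Rmult_le_compat_r; lra. }
      assert (level k * (2 * ep) * X (dip k) <= C0 * level (S k) * X (dip k))
        by (apply Rmult_le_compat_r; trivial).
      lra.
Qed.

(** * From coefficients to functions: boundedness on the weighted space *)

Lemma expansion_ps f a : expansion f a <-> forall z, Cmod z < 1 -> ps a z (f z).
Proof.
  split; intros H z Hz; apply ps_is_pseries, H, Hz.
Qed.

Lemma expansion_converges f a : expansion f a -> converges_within a 1.
Proof. rewrite expansion_ps. intros H z Hz. exists (f z). now apply H. Qed.

Lemma expansion_unique f a b : expansion f a -> expansion f b -> forall n, a n = b n.
Proof.
  rewrite !expansion_ps. intros Ha Hb. apply (ps_unique a b 1); [lra|].
  intros z Hz. exists (f z). auto.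
Qed.

Lemma symbol_maps_disk phi c : symbol phi -> expansion phi c -> maps_disk c.
Proof.
  rewrite expansion_ps. intros [_ [H _]] He z Hz. exists (phi z). split; [auto|].
  left. now apply H.
Qed.

Lemma expansion_at_0 phi c : expansion phi c -> c 0%nat = phi (RtoC 0).
Proof.
  rewrite expansion_ps. intros H. assert (E := H 0 ltac:(rewrite Cmod_0; lra)).
  assert (Z : forall n, (1 <= n)%nat -> (c n * 0 ^ n)%C = RtoC 0)
    by (intros [|n] Hn; [lia|simpl; ring]).
  rewrite (csums_unique _ _ _ E (csums_fin 1 _ Z)). simpl. ring.
Qed.

Lemma expansion_compose phi c f x : symbol phi -> phi (RtoC 0) = RtoC 0 -> expansion phi c ->
  expansion f x -> expansion (comp_op phi f) (compose c x).
Proof.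
  intros Hs H0 Hc Hx. assert (Md := symbol_maps_disk _ _ Hs Hc).
  assert (c0 := expansion_at_0 _ _ Hc). rewrite H0 in c0.
  assert (Cx := expansion_converges _ _ Hx). rewrite expansion_ps in *. intros z Hz.
  apply (ps_compose c x z (phi z)); auto. apply Hx. now apply Hs.
Qed.

Lemma weighted_sqr_pos x n : 0 <= Cmod (x n) ^ 2 * weight n.
Proof. apply Rmult_le_pos; [apply pow2_ge_0|left; apply weight_pos]. Qed.

Lemma weighted_compose_series c : maps_disk c -> c 0%nat = RtoC 0 ->
  exists K, 0 <= K /\ forall x, ex_series (fun n => Cmod (x n) ^ 2 * weight n) ->
    ex_series (fun n => Cmod (compose c x n) ^ 2 * weight n) /\
    Series (fun n => Cmod (compose c x n) ^ 2 * weight n) <=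
    K * Series (fun n => Cmod (x n) ^ 2 * weight n).
Proof.
  intros Hc c0. destruct (weighted_compose_bound c Hc c0) as [K [PK HK]].
  exists K; split; trivial. intros x Hx.
  apply bounded_ex_series; [intros; apply weighted_sqr_pos|]. apply HK. intros n.
  apply rsum_le_Series; trivial. intros; apply weighted_sqr_pos.
Qed.

Lemma weight_bounded_comp_op phi : symbol phi -> phi (RtoC 0) = RtoC 0 -> bounded_comp_op weight phi.
Proof.
  intros Hs H0. destruct (disk_expansion phi) as [c Hc].
  { apply Hs. } { intros z Hz. left. now apply Hs. }
  rewrite <- expansion_ps in Hc.
  assert (Md := symbol_maps_disk _ _ Hs Hc).
  assert (c0 := expansion_at_0 _ _ Hc). rewrite H0 in c0.
  destruct (weighted_compose_series c Md c0) as [K [PK HK]]. split.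
  - intros f [x [Hx Sx]]. exists (compose c x). split; [now apply expansion_compose|now apply HK].
  (* [K] bounds squared norms, hence the square root. The coefficients [y] supplied by the norm
     relation are those of [compose c x] by uniqueness. *)
  - exists (sqrt K). intros f N N' [x [Hx [Sx ->]]] [y [Hy [Sy ->]]].
    destruct (HK x Sx) as [S1 S2].
    assert (E := expansion_unique _ _ _ Hy (expansion_compose _ _ _ _ Hs H0 Hc Hx)).
    rewrite (Series_ext _ (fun n => Cmod (compose c x n) ^ 2 * weight n)) by (intros; now rewrite E).
    rewrite <- sqrt_mult_alt by trivial. now apply sqrt_le_1_alt.
Qed.

(** * Symbols with large composition norm *)

Definition quad (t : R) (z : C) : C := (z * (t + (1 - t) * z))%C.

Definition quad_coef (t : R) (n : nat) : C :=
  match n with 1%nat => RtoC t | 2%nat => RtoC (1 - t) | _ => RtoC 0 end.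

Lemma quad_expansion t : expansion (quad t) (quad_coef t).
Proof.
  rewrite expansion_ps. intros z _.
  assert (F := csums_fin 3 (fun n => quad_coef t n * z ^ n)%C).
  replace (quad t z) with (csum 3 (fun n => quad_coef t n * z ^ n)%C).
  - apply F. intros [|[|[|n]]] Hn; try lia. simpl. ring.
  - unfold quad. simpl. rewrite RtoC_minus. ring.
Qed.

(** A quadratic polynomial has a finite Taylor expansion at every centre; [t + (1 - t) z] is a
    convex combination of 1 and [z], hence of modulus at most 1; the values at 0 and 1/2 differ. *)
Lemma quad_symbol t : 0 < t < 1 -> symbol (quad t).
Proof.
  intros Ht. split; [|split].
  - intros z _. exists (fun n => match n with 0%nat => quad t z | 1%nat => (t + 2 * (1 - t) * z)%C
      | 2%nat => (1 - t)%C | _ => RtoC 0 end), 1. split; [lra|]. intros h _. apply ps_is_pseries.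
    match goal with |- ps ?a _ _ => assert (F := csums_fin 3 (fun n => a n * h ^ n)%C);
      replace (quad t (z + h)%C) with (csum 3 (fun n => a n * h ^ n)%C) end.
    + apply F. intros [|[|[|n]]] Hn; try lia. ring.
    + unfold quad. simpl. ring.
  - intros z Hz. unfold disk, quad in *. rewrite Cmod_mult.
    assert (Cmod (t + (1 - t) * z) <= 1).
    { eapply Rle_trans; [apply Cmod_triangle|].
      rewrite <- RtoC_minus, Cmod_mult, !Cmod_R, !Rabs_pos_eq by lra. nra. }
    assert (P := Cmod_ge_0 z). assert (P' := Cmod_ge_0 (t + (1 - t) * z)). nra.
  - exists (RtoC 0), (RtoC (/ 2)). unfold disk. rewrite !Cmod_R, Rabs_R0, Rabs_pos_eq by lra.
    repeat split; try lra. unfold quad. rewrite Cmult_0_l, <- RtoC_minus, <- !RtoC_mult, <- RtoC_plus, <- RtoC_mult.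
    intros E. apply RtoC_inj in E. nra.
Qed.

(** The test function is the normalized monomial of degree [d = dip k]: its composition has a
    sizeable coefficient at [d + 1], where the weight is [k + 3] times larger. *)
Lemma comp_op_norm_quad k : exists phi, symbol phi /\ phi (RtoC 0) = RtoC 0 /\
  Rbar_le (sqrt ((INR k + 3) / 16)) (comp_op_norm weight phi).
Proof.
  set (d := dip k). assert (Pd : 1 <= INR d) by (apply (le_INR 1), dip_pos).
  (* Chosen so that [d (1 - t) = 1/2] while Bernoulli's inequality keeps [t^(d-1) >= 1/2]; the
     coefficient [d t^(d-1) (1 - t)] is then at least 1/4. *)
  set (t := 1 - / (2 * INR d)).
  assert (It : 0 < / (2 * INR d) <= / 2)
    by (split; [apply Rinv_0_lt_compat; lra|apply Rinv_le_contravar; lra]).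
  assert (Ht : 0 < t < 1) by (unfold t; lra).
  assert (Hs := quad_symbol t Ht).
  assert (Q0 : quad t 0 = RtoC 0) by (unfold quad; ring).
  assert (He := quad_expansion t). assert (Md := symbol_maps_disk _ _ Hs He).
  exists (quad t). split; [trivial|split; trivial].
  set (w := / sqrt (weight d)). assert (Pw := weight_pos d).
  assert (Hw : w ^ 2 * weight d = 1).
  { unfold w. rewrite pow_inv, pow2_sqrt by lra. field. lra. }
  set (x := fun n => (w * delta d n)%C).
  assert (Hx : forall n, n <> d -> x n = RtoC 0).
  { intros n N. unfold x, delta. destruct (Nat.eq_dec n d); [lia|ring]. }
  assert (Hxd : x d = RtoC w) by (unfold x, delta; destruct (Nat.eq_dec d d); [ring|lia]).
  set (f := fun z => (w * z ^ d)%C).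
  assert (Hf : expansion f x).
  { rewrite expansion_ps. intros z _.
    replace (f z) with (csum (S d) (fun n => x n * z ^ n)%C).
    - apply csums_fin. intros n Hn. rewrite Hx by lia. ring.
    - rewrite (csum_single (S d) d); [now rewrite Hxd|lia|].
      intros i _ N. rewrite Hx by trivial. ring. }
  destruct (bounded_ex_series (fun n => Cmod (x n) ^ 2 * weight n) 1) as [Sx Lx].
  { intros; apply weighted_sqr_pos. }
  { intros n. apply Rle_trans with (rsum (S d) (fun n => Cmod (x n) ^ 2 * weight n)).
    - destruct (Nat.le_gt_cases n (S d)) as [L|L].
      + apply rsum_mono; trivial. intros; apply weighted_sqr_pos.
      + replace n with (S d + (n - S d))%nat by lia. rewrite rsum_add.
        rewrite (rsum_ext (n - S d) _ (fun _ => 0)), rsum_const; [lra|].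
        intros i _. rewrite Hx by lia. rewrite Cmod_0; ring.
    - cbn [rsum]. rewrite (rsum_ext d _ (fun _ => 0)), rsum_const, Hxd, Cmod_R, pow2_abs; [lra|].
      intros i Hi. rewrite Hx by lia. rewrite Cmod_0; ring. }
  destruct (weighted_compose_series _ Md eq_refl) as [K [_ HK]].
  destruct (HK x Sx) as [Sy _]. set (y := compose (quad_coef t) x) in *.
  assert (Hy : y (S d) = (w * (INR d * (t ^ (d - 1) * (1 - t))))%C).
  { unfold y, compose. rewrite (csum_single (S (S d)) d); [|lia|].
    - rewrite Hxd, pw_next by trivial. simpl quad_coef. now rewrite RtoC_minus.
    - intros i _ N. rewrite Hx by trivial. ring. }
  (* The square of 1/4 gives the 16, and the normalization by [w] turns the weight at [d + 1] into
     the ratio [k + 3]. *)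
  assert (Ly : (INR k + 3) / 16 <= Cmod (y (S d)) ^ 2 * weight (S d)).
  { rewrite Hy.
    assert (Eq1 : INR d * (t ^ (d - 1) * (1 - t)) = t ^ (d - 1) / 2)
      by (unfold t at 2; field; lra).
    assert (Bt : / 2 <= t ^ (d - 1)).
    { eapply Rle_trans; [|apply bernoulli; lra].
      assert (INR (d - 1) * / (2 * INR d) <= INR d * / (2 * INR d))
        by (apply Rmult_le_compat_r; [lra|apply le_INR; lia]).
      replace (INR d * / (2 * INR d)) with (/ 2) in H by (field; lra). lra. }
    replace (Cmod _) with (Rabs (w * (INR d * (t ^ (d - 1) * (1 - t))))).
    2:{ rewrite <- Cmod_R. f_equal. now rewrite !RtoC_mult, RtoC_pow, RtoC_minus. }
    rewrite pow2_abs, Rpow_mult_distr, Eq1.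
    assert (Hww : w ^ 2 * weight (S d) = INR k + 3).
    { unfold d in Hw |- *. rewrite weight_after_dip, level_succ, <- weight_dip.
      transitivity ((w ^ 2 * weight (dip k)) * (INR k + 3)); [ring|]. rewrite Hw. ring. }
    replace (w ^ 2 * (t ^ (d - 1) / 2) ^ 2 * weight (S d)) with
      ((w ^ 2 * weight (S d)) * (t ^ (d - 1) / 2) ^ 2) by ring.
    rewrite Hww. unfold Rdiv at 1. apply Rmult_le_compat_l; [generalize (pos_INR k); lra|]. nra. }
  assert (Lr : Rbar_le (sqrt (Series (fun n => Cmod (y n) ^ 2 * weight n))) (comp_op_norm weight (quad t))).
  { unfold comp_op_norm. apply Lub_Rbar_correct. exists f, (sqrt (Series (fun n => Cmod (x n) ^ 2 * weight n))).
    split; [now exists x|]. split.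
    - rewrite <- sqrt_1. now apply sqrt_le_1_alt.
    - exists y. split; [now apply expansion_compose|]. now split. }
  eapply Rbar_le_trans; [|exact Lr]. simpl. apply sqrt_le_1_alt.
  eapply Rle_trans; [exact Ly|].
  eapply Rle_trans; [|apply (rsum_le_Series _ (S (S d))); trivial; intros; apply weighted_sqr_pos].
  apply (rsum_term_le (S (S d)) (S d) (fun n => Cmod (y n) ^ 2 * weight n)); [|lia].
  intros; apply weighted_sqr_pos.
Qed.

Theorem theorem3p7 :
  exists beta : nat -> R,
    positive_seq beta /\
    bounded_seq beta /\
    polynomial_decay beta /\
    ~ essentially_decreasing beta /\
    (forall phi : C -> C,
       symbol phi -> phi (RtoC 0) = RtoC 0 -> bounded_comp_op beta phi) /\
    Rbar_is_lub
      (fun r : Rbar => exists phi : C -> C,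
         symbol phi /\ phi (RtoC 0) = RtoC 0 /\ r = comp_op_norm beta phi)
      p_infty.
Proof.
  exists weight. repeat apply conj.
  - exact weight_pos.
  - exists 1. intros n. eapply Rle_trans; [apply weight_le_level|apply level_le_1].
  - exists (/ 2), 1. repeat split; try lra. intros n Hn.
    rewrite Rpower_Ropp, Rpower_1; [now apply weight_ge_inv|]. apply lt_0_INR; lia.
  (* The jump just after [dip k] has ratio [k + 3], which exceeds any constant. *)
  - intros [K [_ HK]]. destruct (INR_unbounded K) as [k Hk].
    specialize (HK (S (dip k)) (dip k) ltac:(lia)).
    rewrite weight_after_dip, weight_dip, level_succ in HK.
    apply Rmult_le_reg_r in HK; [lra|apply level_pos].
  - exact weight_bounded_comp_op.
  - intros r _. now destruct r.
  - intros b Hb.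
    assert (L : forall k, Rbar_le (sqrt ((INR k + 3) / 16)) b).
    { intros k. destruct (comp_op_norm_quad k) as [phi [H1 [H2 H3]]].
      eapply Rbar_le_trans; [exact H3|]. apply Hb. now exists phi. }
    destruct b as [b| |]; [|easy|].
    (* A finite upper bound [b] is refuted by any [k > 16 b^2], since then [(k + 3) / 16 > b^2]. *)
    + destruct (INR_unbounded (16 * b ^ 2)) as [k Hk]. specialize (L k). simpl in L.
      assert (Hs : 0 <= (INR k + 3) / 16) by (generalize (pos_INR k); lra).
      assert (E := sqrt_sqrt _ Hs). assert (P := sqrt_pos ((INR k + 3) / 16)).
      assert (sqrt ((INR k + 3) / 16) * sqrt ((INR k + 3) / 16) <= b * b) by nra. nra.
    + now specialize (L 0%nat).
Qed.
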